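(* $\mathcal{M}(\partial\Delta^3)\simeq\bigvee^{21}S^3\vee\bigvee^{24}S^4$.
   Context: All simplicial complexes are finite abstract simplicial complexes; simplices are nonempty. $\partial\Delta^3$ is the simplicial complex of all proper nonempty subsets of a $4$-element vertex set (the boundary of the tetrahedron). The Hasse diagram $\mathcal{H}(K)$ of $K$ is the directed graph whose vertices are the simplices of $K$, with an edge $\sigma\to\tau$ whenever $\sigma\subsetneq\tau$ and $\dim\tau=\dim\sigma+1$. A matching on $\mathcal{H}(K)$ is a set $W$ of edges of $\mathcal{H}(K)$, no two sharing a vertex. $W$ is acyclic if the directed graph obtained from $\mathcal{H}(K)$ by reversing every edge in $W$ has no directed cycle. The complex of discrete Morse matchings $\mathcal{M}(K)$ is the simplicial complex whose vertices are the edges of $\mathcal{H}(K)$ and whose simplices are the nonempty acyclic matchings on $\mathcal{H}(K)$. *)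

(* Defs.v *)
From HB Require Import structures.
From mathcomp Require Import all_boot all_order all_algebra.
From mathcomp Require Import all_classical all_reals all_analysis.
From mathcomp Require Import wedge_sigT.
Set Implicit Arguments. Unset Strict Implicit. Unset Printing Implicit Defensive.
Import Order.TTheory GRing.Theory Num.Theory.
Import numFieldNormedType.Exports.
Local Open Scope classical_set_scope.
Local Open Scope ring_scope.

(* A finite abstract simplicial complex on a vertex finType V is given by the
   predicate "is a simplex" on {set V}. *)

Definition bdry_tetra : pred {set 'I_4} :=
  fun s => (0 < #|s|)%N && (#|s| < 4)%N.

Definition hasse_edge (V : finType) (K : pred {set V}) : pred ({set V} * {set V}) :=
  fun e => [&& K e.1, K e.2, e.1 \proper e.2 & #|e.2| == #|e.1|.+1].

Definition HEdge (V : finType) (K : pred {set V}) := {e | hasse_edge K e}.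

Definition is_matching (V : finType) (K : pred {set V}) (W : {set HEdge K}) : Prop :=
  forall e f, e \in W -> f \in W -> e != f ->
    [/\ (val e).1 != (val f).1, (val e).1 != (val f).2,
        (val e).2 != (val f).1 & (val e).2 != (val f).2].

Definition modified_hasse (V : finType) (K : pred {set V}) (W : {set HEdge K})
  : rel {set V} :=
  fun a b => [exists e : HEdge K,
    ((e \notin W) && (val e == (a, b))) || ((e \in W) && (val e == (b, a)))].

Definition is_acyclic (V : finType) (K : pred {set V}) (W : {set HEdge K}) : Prop :=
  ~ exists c : seq {set V}, c != [::] /\ cycle (modified_hasse W) c.

Definition morse_complex (V : finType) (K : pred {set V}) : set {set HEdge K} :=
  [set W | W != finset.set0 /\ is_matching W /\ is_acyclic W].

Definition realization (R : realType) (E : finType) (L : set {set E})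
  : set 'rV[R]_#|E| :=
  [set x : 'rV[R]_#|E| | (forall e : E, 0 <= x ord0 (enum_rank e)) /\
           \sum_(e : E) x ord0 (enum_rank e) = 1 /\
           L (finset (fun e : E => x ord0 (enum_rank e) != 0))].

Definition unit_interval (R : realType) : set R := `[0, 1]%classic.

Definition I01 (R : realType) : topologicalType :=
  set_type (@unit_interval R).

Definition homotopic (R : realType) (X Y : topologicalType) (f g : X -> Y) : Prop :=
  exists H : (I01 R * X)%type -> Y,
    continuous H /\
    (forall t x, set_val t = 0 -> H (t, x) = f x) /\
    (forall t x, set_val t = 1 -> H (t, x) = g x).

Definition homotopy_equivalent (R : realType) (X Y : topologicalType) : Prop :=
  exists (f : X -> Y) (g : Y -> X),
    continuous f /\ continuous g /\
    homotopic R (g \o f) idfun /\ homotopic R (f \o g) idfun.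

Definition sphere (R : realType) (n : nat) : set 'rV[R]_n.+1 :=
  [set x | \sum_(i < n.+1) x ord0 i ^+ 2 = 1].

Definition sphere_base_vec (R : realType) (n : nat) : 'rV[R]_n.+1 :=
  \row_(i < n.+1) (if i == ord0 then 1 else 0).

Lemma sphere_base_in (R : realType) (n : nat) : @sphere R n (@sphere_base_vec R n).
Proof.
rewrite /sphere /sphere_base_vec /=.
rewrite big_ord_recl.
rewrite !mxE eqxx expr1n big1 ?addr0 // => i _.
by rewrite mxE eq_sym (negbTE (neq_lift _ _)) expr0n.
Qed.

Definition sphere_base (R : realType) (n : nat) : set_type (@sphere R n) :=
  @exist _ (fun x => x \in @sphere R n) (@sphere_base_vec R n)
    (mem_set (@sphere_base_in R n)).

Definition sph_dim (m n a b : nat) (i : ('I_a + 'I_b)%type) : nat :=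
  if i is inl _ then m else n.

Definition sphere_wedge (R : realType) (m n a b : nat) : topologicalType :=
  @wedge ('I_a + 'I_b)%type
    (fun i => set_type (@sphere R (sph_dim m n i)) : topologicalType)
    (fun i => @sphere_base R (sph_dim m n i)).

(* Main.v *)
Require Import Defs.
From HB Require Import structures.
From Stdlib Require Import NArith.
From mathcomp Require Import all_boot all_order all_algebra.
From mathcomp Require Import all_classical all_reals all_analysis.
From mathcomp Require Import wedge_sigT.
From mathcomp Require Import ring lra zify.
Set Implicit Arguments. Unset Strict Implicit. Unset Printing Implicit Defensive.
Import Order.TTheory GRing.Theory Num.Theory.
Import numFieldNormedType.Exports.
Local Open Scope classical_set_scope.
Local Open Scope ring_scope.

(** Whenever the link of a simplex is a cone, its open star can be pushed off towards the apex. A chain of such collapses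
    takes the complex M of the theorem, which has 4332 simplices, to a subcomplex L with 21 facets of dimension 3 and 24
    facets of dimension 4 whose removal leaves a complex C, and a second chain contracts C to a vertex. Hence
    |M| ~ |L| ~ |L| / |C|, and crushing |C| to a point turns each of the 45 facets into a sphere. The contraction of |C|
    is extended to |L| by an explicit formula, and maps out of the wedge are obtained by factoring maps on |L| through the
    quotient map from the compact space |L| to the Hausdorff wedge. *)

(** * Quotients by contractible subspaces *)

(** A count of critical cells alone would not determine the homotopy type, since a 4-dimensional
    cell could be attached nontrivially along 3-dimensional ones. Here all 45 cells are facets of
    the same subcomplex, so their boundaries lie in the contractible C and no attaching map remains
    to be understood; a facet with d + 1 vertices becomes a sphere of dimension d because its whole
    boundary goes to the base point. The homotopy inverse of the crushing map is the time-one map of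
    the extended contraction: it is constant on C, hence descends to the wedge. The topological
    statements are about arbitrary complexes given with collapses and facets. What concerns this
    particular complex is finite: listing the acyclic matchings, testing the cone condition at each
    collapse, and testing maximality of the 45 facets. *)

Lemma set_val_continuous (T : topologicalType) (A : set T) :
  continuous (set_val : set_type A -> T).
Proof. exact: initial_continuous. Qed.

Lemma continuous_to_set_type (S T : topologicalType) (A : set T)
    (f : S -> set_type A) :
  continuous (fun x => set_val (f x)) -> continuous f.
Proof.
move=> cf; apply/continuousP => _ [B oB <-].
by move/continuousP: cf => /(_ B oB).
Qed.

Lemma continuous_pair (S T U : topologicalType) (f : S -> T) (g : S -> U) :
  continuous f -> continuous g -> continuous (fun x => (f x, g x)).
Proof. by move=> cf cg x; apply: cvg_pair; [exact: cf|exact: cg]. Qed.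

Lemma continuous_compose (S T U : topologicalType) (f : S -> T) (g : T -> U) :
  continuous f -> continuous g -> continuous (fun x => g (f x)).
Proof. by move=> cf cg x; apply: continuous_comp; [exact: cf|exact: cg]. Qed.

Lemma continuous_fst (S T : topologicalType) : continuous (@fst S T).
Proof. by move=> p; exact: cvg_fst. Qed.

Lemma continuous_snd (S T : topologicalType) : continuous (@snd S T).
Proof. by move=> p; exact: cvg_snd. Qed.

Lemma compact_set_type (T : topologicalType) (A : set T) :
  compact A -> compact [set: set_type A].
Proof.
move=> cA; have [->|/set0P[x0 _]] := eqVneq [set: set_type A] set0.
  exact: compact0.
pose f x : set_type A :=
  if pselect (A x) is left h then exist _ x (mem_set h) else x0.
have fK (x : set_type A) : f (set_val x) = x.
  rewrite /f; case: pselect => [h|[]]; last exact: set_valP.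
  exact: val_inj.
have -> : [set: set_type A] = f @` A.
  rewrite eqEsubset; split=> // x _.
  by exists (set_val x); [exact: set_valP|exact: fK].
apply: continuous_compact => //; apply/subspace_sigL_continuousP.
apply: continuous_to_set_type; rewrite (_ : (fun _ => _) = set_val).
  exact: set_val_continuous.
by apply/funext => x; rewrite /sigL /= fK.
Qed.

Lemma hausdorff_injective (S T : topologicalType) (f : S -> T) :
  continuous f -> injective f -> hausdorff_space T -> hausdorff_space S.
Proof.
move=> cf fI hT x y xy; apply/fI/hT => U V /cf nU /cf nV.
by have [z [/= ? ?]] := xy _ _ nU nV; exists (f z).
Qed.

Lemma hausdorff_pair (S T : topologicalType) :
  hausdorff_space S -> hausdorff_space T -> hausdorff_space (S * T)%type.
Proof.
move=> hS hT [x1 x2] [y1 y2] xy; congr pair.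
  apply: hS => U V nU nV.
  have [z [/= ? ?]] := xy _ _ (@cvg_fst _ _ _ _ _ U nU) (@cvg_fst _ _ _ _ _ V nV).
  by exists z.1.
apply: hT => U V nU nV.
have [z [/= ? ?]] := xy _ _ (@cvg_snd _ _ _ _ _ U nU) (@cvg_snd _ _ _ _ _ V nV).
by exists z.2.
Qed.

(* A continuous surjection from a compact space onto a Hausdorff space is a closed map, hence a quotient map. *)
Lemma continuous_factor (S T Z : topologicalType) (f : S -> T) (h : T -> Z) :
  compact [set: S] -> hausdorff_space T -> continuous f ->
  (forall y, exists x, f x = y) -> continuous (h \o f) -> continuous h.
Proof.
move=> cS hT cf sf chf; apply/continuous_closedP => B cB.
have -> : h @^-1` B = f @` ((h \o f) @^-1` B).
  rewrite eqEsubset; split => [y By|_ [x /= Bx <-]//].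
  by have [x fx] := sf y; exists x => //=; rewrite fx.
apply: compact_closed => //; apply: continuous_compact.
  exact: continuous_subspaceT.
apply: (subclosed_compact _ cS) => //.
by move/continuous_closedP : chf => /(_ B cB).
Qed.

Lemma compact_I01 (R : realType) : compact [set: I01 R].
Proof. exact: compact_set_type (@segment_compact R 0 1). Qed.

Lemma I01P (R : realType) (t : I01 R) : 0 <= set_val t <= 1.
Proof. by have := set_valP t; rewrite /unit_interval /= in_itv. Qed.

(* Every map below is continuous on the whole of [R * V]; the homotopies run from the identity at time 0 so that
   they can be concatenated by nesting rather than by pasting. *)
Section collapse_contractible.
Variables (R : realType) (V W : topologicalType) (K K1 C : set V).
Variables (D H : R * V -> V) (f1 : set_type K1 -> W) (c0 : V).
Hypothesis (contD : continuous D) (contH : continuous H).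
Hypothesis D0 : forall x, D (0, x) = x.
Hypothesis DK : forall (t : R) x, 0 <= t <= 1 -> K x -> K (D (t, x)).
Hypothesis D1 : forall x, K x -> K1 (D (1, x)).
Hypothesis D1id : forall x, K1 x -> D (1, x) = x.
Hypothesis K1K : K1 `<=` K.
Hypothesis H0 : forall x, H (0, x) = x.
Hypothesis HK1 : forall (t : R) x, 0 <= t <= 1 -> K1 x -> K1 (H (t, x)).
Hypothesis HC : forall (t : R) x, 0 <= t <= 1 -> C x -> C (H (t, x)).
Hypothesis H1C : forall x, C x -> H (1, x) = c0.
Hypothesis cptK1 : compact K1.
Hypothesis hausW : hausdorff_space W.
Hypothesis contf1 : continuous f1.
Hypothesis f_surj : forall w, exists x, f1 x = w.
Hypothesis f_fib : forall x y, f1 x = f1 y ->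
  set_val x = set_val y \/ C (set_val x) /\ C (set_val y).
Hypothesis f_C : forall x y, C (set_val x) -> C (set_val y) -> f1 x = f1 y.

Let mk (A : set V) x (h : A x) : set_type A := exist _ x (mem_set h).
Let KP (x : set_type K) : K (set_val x) := set_valP x.
Let K1P (x : set_type K1) : K1 (set_val x) := set_valP x.
Let in1 : 0 <= (1 : R) <= 1. Proof. by rewrite ler01 lexx. Qed.
(** A preimage is merely chosen, with no continuity. It is only used under maps that take equal
    values on points with the same image, so the choice does not show. *)
Let sec (w : W) : {x : set_type K1 | f1 x = w}.
Proof. exact: cid (f_surj w). Qed.
Let r w := proj1_sig (sec w).
Let rK w : f1 (r w) = w. Proof. exact: proj2_sig (sec w). Qed.
Let r_fib (x : set_type K1) :
  set_val (r (f1 x)) = set_val x \/ C (set_val (r (f1 x))) /\ C (set_val x).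
Proof. by apply: f_fib; exact: rK. Qed.
Let F (x : set_type K) : W := f1 (mk (D1 (KP x))).
Let g (w : W) : set_type K := mk (K1K (HK1 in1 (K1P (r w)))).

Let contpair (A : set V) (s : I01 R * set_type A -> R) (G : R * V -> V)
    (u : I01 R * set_type A -> V) :
  continuous s -> continuous G -> continuous u ->
  continuous (fun p => G (s p, u p)).
Proof. by move=> cs cG cu; exact: continuous_compose (continuous_pair cs cu) cG. Qed.

Let conttime (A : set V) : continuous (fun p : I01 R * set_type A => set_val p.1).
Proof. exact: continuous_compose (@continuous_fst _ _) (@set_val_continuous _ _). Qed.

Let contpt (A : set V) : continuous (fun p : I01 R * set_type A => set_val p.2).
Proof. exact: continuous_compose (@continuous_snd _ _) (@set_val_continuous _ _). Qed.

Let contslice (A : set V) (t : R) (G : R * V -> V) :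
  continuous G -> continuous (fun x : set_type A => G (t, set_val x)).
Proof.
move=> cG; apply: continuous_compose cG; apply: continuous_pair.
  exact: cst_continuous.
exact: set_val_continuous.
Qed.

Let contF : continuous F.
Proof.
move=> x; apply: (@continuous_comp _ _ _ (fun x => mk (D1 (KP x))) f1).
  apply: continuous_to_set_type; exact: (@contslice K 1 D contD).
exact: contf1.
Qed.

Let contg : continuous g.
Proof.
apply: (continuous_factor (compact_set_type cptK1) hausW contf1 f_surj).
apply: continuous_to_set_type.
rewrite (_ : (fun _ => _) = fun x : set_type K1 => H (1, set_val x)).
  exact: contslice.
apply/funext => x; change (H (1, set_val (r (f1 x))) = H (1, set_val x)).
have [->//|[Cx Cy]] := r_fib x.
by rewrite !H1C.
Qed.

Let contsub (A : set V) : continuous (fun p : I01 R * set_type A => 1 - set_val p.1).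
Proof.
by move=> p; apply: cvgB; [exact: cvg_cst|exact: conttime].
Qed.

(** [g (F x)] is [H (1, D (1, x))], because [H (1, _)] is constant on the fibres of [f1]; running
    [D] and then [H] joins it to the identity. [F (g w)] is [f1 (H (1, r w))], because [D (1, _)]
    fixes [K1]; here [H] alone is enough, and it descends to [W] at every time since it preserves
    [C]. *)
Lemma collapse_contractible_equivalence : homotopy_equivalent R (set_type K) W.
Proof.
exists F, g; split; [exact: contF|split; [exact: contg|split]].
- have min01 (s : R) : 0 <= s <= 1 -> 0 <= Num.min 1 (2 * s) <= 1.
    by move=> /andP[s0 s1]; rewrite ge_min lexx /= le_min ler01 mulr_ge0.
  have max01 (s : R) : 0 <= s <= 1 -> 0 <= Num.max 0 (2 * s - 1) <= 1.
    by move=> /andP[s0 s1]; rewrite le_max lexx ge_max ler01 /=; lra.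
  have rev01 (t : I01 R) : 0 <= 1 - set_val t <= 1.
    by have /andP[t0 t1] := I01P t; lra.
  (* [homotopic] wants the composite at time 0 and the identity at time 1, so time is reversed: with
     s = 1 - t, [D] runs while s goes from 0 to 1/2 and [H] while s goes from 1/2 to 1. *)
  pose u (p : I01 R * set_type K) := D (Num.min (1 : R) (2 * (1 - set_val p.1)), set_val p.2).
  pose v (p : I01 R * set_type K) := H (Num.max (0 : R) (2 * (1 - set_val p.1) - 1), u p).
  have vK (p : I01 R * set_type K) : K (v p).
    rewrite /v /u; have [t2|t2] := lerP 1 (2 * (1 - set_val p.1)).
      by apply/K1K/HK1; [exact/max01/rev01|exact/D1/KP].
    have -> : Num.max 0 (2 * (1 - set_val p.1) - 1) = 0 :> R.
      by apply/max_idPl; lra.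
    rewrite H0; apply: DK; last exact: KP.
    by have /andP[? ?] := rev01 p.1; lra.
  exists (fun p => mk (vK p)); split; [|split].
  + apply: continuous_to_set_type; rewrite (_ : (fun _ => _) = v) //.
    apply: contpair => // [p|].
      apply: (@continuous_max _ _ (fun=> 0) (fun p : I01 R * set_type K => 2 * (1 - set_val p.1) - 1)).
        exact: cvg_cst.
      apply: cvgB; last exact: cvg_cst.
      by apply: cvgM; [exact: cvg_cst|exact: contsub].
    apply: contpair => // p.
    apply: (@continuous_min _ _ (fun=> 1) (fun p : I01 R * set_type K => 2 * (1 - set_val p.1))).
      exact: cvg_cst.
    by apply: cvgM; [exact: cvg_cst|exact: contsub].
  + move=> t x t0; apply: val_inj; change (v (t, x) = H (1, set_val (r (F x)))).
    rewrite /v /u /= t0 subr0 mulr1.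
    have -> : Num.min 1 2 = 1 :> R by apply/min_idPl; lra.
    have -> : Num.max 0 (2 - 1) = 1 :> R by rewrite max_r; lra.
    have [->//|[Cx Cy]] := r_fib (mk (D1 (KP x))).
    by rewrite [RHS]H1C ?H1C.
  + move=> t x t1; apply: val_inj; change (v (t, x) = set_val x); rewrite /v /u /= t1 subrr mulr0.
    have -> : Num.min 1 0 = 0 :> R by apply/min_idPr; lra.
    have -> : Num.max 0 (0 - 1) = 0 :> R by rewrite max_l; lra.
    by rewrite D0 H0.
- have GK1 (p : I01 R * set_type K1) : K1 (H (1 - set_val p.1, set_val p.2)).
    by apply: HK1; [have /andP[? ?] := I01P p.1; lra|exact: K1P].
  have f1_val (x y : set_type K1) : set_val x = set_val y -> f1 x = f1 y.
    by move=> /val_inj ->.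
  pose q (p : I01 R * set_type K1) : I01 R * W := (p.1, f1 p.2).
  pose G (p : I01 R * W) : W := f1 (mk (GK1 (p.1, r p.2))).
  have cq : continuous q.
    move=> p; apply: (@cvg_pair _ _ _ _ (nbhs p.1) (nbhs (f1 p.2))).
      exact: cvg_fst.
    apply: (@continuous_comp _ _ _ snd f1); first exact: cvg_snd.
    exact: contf1.
  have Gq : G \o q = fun p => f1 (mk (GK1 p)).
    apply/funext => -[t x]; rewrite /G /q /=.
    have t01 : 0 <= 1 - set_val t <= 1 by have /andP[? ?] := I01P t; lra.
    have [rx|[Cx Cy]] := r_fib x; last by apply: f_C; exact: HC.
    by apply: f1_val; exact: (congr1 (fun y => H (1 - set_val t, y)) rx).
  exists G; split; [|split].
  (* Multiplying by the compact interval keeps the source compact and the target Hausdorff, so [q]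
     is a quotient map like [f1]. *)
  + apply: (@continuous_factor _ _ _ q).
    * have -> : [set: I01 R * set_type K1] = [set: I01 R] `*` [set: set_type K1].
        by apply/seteqP; split.
      by apply: compact_setX; [exact: compact_I01|exact: compact_set_type].
    * apply: hausdorff_pair => //.
      by apply: (@hausdorff_injective _ _ set_val); [exact: set_val_continuous|exact: val_inj|].
    * exact: cq.
    * by move=> [t w]; have [x xw] := f_surj w; exists (t, x); rewrite /q /= xw.
    * rewrite Gq => p; apply: (@continuous_comp _ _ _ (fun p => mk (GK1 p)) f1).
        apply: continuous_to_set_type; exact: (contpair (@contsub K1) contH (@contpt K1)).
      exact: contf1.
  + move=> t w t0; apply: f1_val.
    change (H (1 - set_val t, set_val (r w)) = D (1, H (1, set_val (r w)))).
    by rewrite t0 subr0 D1id //; exact: HK1.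
  + move=> t w t1; rewrite -[RHS](rK w); apply: f1_val.
    change (H (1 - set_val t, set_val (r w)) = set_val (r w)).
    by rewrite t1 subrr H0.
Qed.
End collapse_contractible.

(** * Realizations in barycentric coordinates *)

Section continuous_scalar.
Variables (R : realType) (T : topologicalType).
Implicit Types f g : T -> R.

Lemma continuousD_fun f g : continuous f -> continuous g ->
  continuous (fun x => f x + g x).
Proof. by move=> cf cg x; apply: cvgD; [exact: cf|exact: cg]. Qed.

Lemma continuousB_fun f g : continuous f -> continuous g ->
  continuous (fun x => f x - g x).
Proof. by move=> cf cg x; apply: cvgB; [exact: cf|exact: cg]. Qed.

Lemma continuousM_fun f g : continuous f -> continuous g ->
  continuous (fun x => f x * g x).
Proof. by move=> cf cg x; apply: cvgM; [exact: cf|exact: cg]. Qed.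

Lemma continuousV_fun f : continuous f -> (forall x, f x != 0) ->
  continuous (fun x => (f x)^-1).
Proof. by move=> cf f0 x; apply: cvgV; [exact: f0|exact: cf]. Qed.

Lemma continuous_min_fun f g : continuous f -> continuous g ->
  continuous (fun x => Num.min (f x) (g x)).
Proof. by move=> cf cg x; apply: (@continuous_min _ _ f g); [exact: cf|exact: cg]. Qed.

Lemma continuous_max_fun f g : continuous f -> continuous g ->
  continuous (fun x => Num.max (f x) (g x)).
Proof. by move=> cf cg x; apply: (@continuous_max _ _ f g); [exact: cf|exact: cg]. Qed.

Lemma continuous_sum_fun (I : Type) (r : seq I) (P : pred I) (F : I -> T -> R) :
  (forall i, continuous (F i)) -> continuous (fun x => \sum_(i <- r | P i) F i x).
Proof.
move=> cF; elim: r => [|i r IH].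
  rewrite (_ : (fun _ => _) = fun=> 0); first exact: cst_continuous.
  by apply/funext => x; rewrite big_nil.
rewrite (_ : (fun _ => _) = fun x =>
    (if P i then F i x else 0) + \sum_(j <- r | P j) F j x).
  by apply: continuousD_fun => //; case: (P i) => //; exact: cst_continuous.
by apply/funext => x; rewrite big_cons; case: ifP; rewrite ?add0r.
Qed.

Lemma continuous_bigmin_fun (I : Type) (r : seq I) (P : pred I) (F : I -> T -> R) (c : R) :
  (forall i, continuous (F i)) ->
  continuous (fun x => \big[Num.min/c]_(i <- r | P i) F i x).
Proof.
move=> cF; elim: r => [|i r IH].
  rewrite (_ : (fun _ => _) = fun=> c); first exact: cst_continuous.
  by apply/funext => x; rewrite big_nil.
case Pi : (P i); last first.
  rewrite (_ : (fun _ => _) = fun x => \big[Num.min/c]_(j <- r | P j) F j x) //.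
  by apply/funext => x; rewrite big_cons Pi.
rewrite (_ : (fun _ => _) = fun x =>
    Num.min (F i x) (\big[Num.min/c]_(j <- r | P j) F j x)).
  exact: continuous_min_fun.
by apply/funext => x; rewrite big_cons Pi.
Qed.

Lemma continuous_row n (F : T -> 'rV[R]_n) :
  (forall j, continuous (fun x => F x ord0 j)) -> continuous F.
Proof.
move=> cF x A [P nP PA]; rewrite nbhs_simpl /=.
have nPF : \forall y \near x, forall j, P ord0 j (F y ord0 j).
  by apply: filter_forall => j; exact: (cF j x _ (nP ord0 j)).
by apply: filterS nPF => y Py; apply: PA => i j; rewrite (ord1 i).
Qed.

End continuous_scalar.

Section barycentric.
Variables (R : realType) (E : finType).
Local Notation V := 'rV[R]_#|E|.
Implicit Types (x y : V) (e v : E) (S s : {set E}) (L : set {set E}).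

Definition bary x e : R := x ord0 (enum_rank e).
Definition bvec (g : E -> R) : V := \row_j g (enum_val j).

Lemma baryE g e : bary (bvec g) e = g e.
Proof. by rewrite /bary mxE enum_rankK. Qed.

Lemma bary_inj x y : (forall e, bary x e = bary y e) -> x = y.
Proof.
by move=> xy; apply/rowP => j; have := xy (enum_val j); rewrite /bary enum_valK.
Qed.

Lemma continuous_bary e : continuous (fun x : V => bary x e).
Proof. exact: coord_continuous. Qed.

Lemma continuous_bvec (T : topologicalType) (G : T -> E -> R) :
  (forall e, continuous (fun p => G p e)) -> continuous (fun p => bvec (G p)).
Proof.
move=> cG; apply: continuous_row => j.
by rewrite (_ : (fun _ => _) = fun p => G p (enum_val j)) //; apply/funext => p; rewrite mxE.
Qed.

Definition face_closed L := forall S S' : {set E},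
  L S -> S' \subset S -> S' != finset.set0 -> L S'.

(** Having support exactly in [L] is awkward to check for a point given by a formula. A bound [S] on
    the support suffices: the support is then a face of [S], nonempty since the coordinates sum to
    1. *)
Lemma realization_face L S x : face_closed L -> L S ->
  (forall e, 0 <= bary x e) -> \sum_e bary x e = 1 ->
  (forall e, e \notin S -> bary x e = 0) -> realization L x.
Proof.
move=> fL LS x0 x1 xS; split => //; split => //; apply: fL LS _ _.
  by apply/fintype.subsetP => e; rewrite inE; apply: contraNT => /xS /eqP.
apply/negP => /eqP s0; move/eqP: x1; apply/negP.
rewrite big1 1?eq_sym ?oner_eq0 // => e _; apply/eqP/negPn/negP => xe.
have : e \in finset (fun e : E => x ord0 (enum_rank e) != 0) by rewrite inE.
by rewrite s0 inE.
Qed.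

(* On a realization the bounds 0 and 1 are immaterial; elsewhere in [V] the clipping makes [facet_extension] start at
   the identity. *)
Definition minb s x : R := Num.max 0 (\big[Num.min/1]_(e in s) bary x e).

Lemma continuous_minb s : continuous (minb s).
Proof.
apply: continuous_max_fun; first exact: cst_continuous.
by apply: continuous_bigmin_fun => e; exact: continuous_bary.
Qed.

Lemma minb_ge0 s x : 0 <= minb s x.
Proof. by rewrite le_max lexx. Qed.

Lemma minb_le s x e : (forall e, 0 <= bary x e) -> e \in s -> minb s x <= bary x e.
Proof. by move=> x0 es; rewrite ge_max x0; exact: bigmin_le_cond. Qed.

Lemma minb_eq0 s x e : (forall e, 0 <= bary x e) -> e \in s -> bary x e = 0 ->
  minb s x = 0.
Proof.
by move=> x0 es xe; apply/le_anti; rewrite minb_ge0 andbT -xe minb_le.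
Qed.

Lemma minb_attained s x : s != finset.set0 ->
  (forall e, 0 <= bary x e) -> (forall e, bary x e <= 1) ->
  exists2 e, e \in s & minb s x = bary x e.
Proof.
case/set0Pn => e0 es x0 x1.
have [e es' min_e] := Order.TotalTheory.arg_minP (bary x) es.
exists e => //; apply/le_anti; rewrite minb_le //=.
by rewrite le_max; apply/orP; right; apply: le_bigmin => //; exact: x1.
Qed.

Lemma bary_le1 x e : (forall e, 0 <= bary x e) -> \sum_e bary x e = 1 -> bary x e <= 1.
Proof.
by move=> x0 <-; rewrite (bigD1 e) //= lerDl sumr_ge0.
Qed.

(** Prescribing the exact support is not a closed condition, but vanishing off [S] is. By face
    closure the realization is the finite union of the closed simplices [spx S], and it lies in the
    unit cube. *)
Lemma compact_realization L : face_closed L -> compact (realization L : set V).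
Proof.
move=> fL; pose spx S : set V := [set x | forall e, 0 <= bary x e] `&`
  [set x | \sum_e bary x e = 1] `&` [set x | forall e, e \notin S -> bary x e = 0].
have cbary e : continuous (fun x : V => bary x e) by exact: continuous_bary.
have -> : realization L = \bigcup_(S in L) spx S.
  rewrite eqEsubset; split => x.
    move=> [x0 [x1 Lx]]; eexists; first exact: Lx.
    by split => // e; rewrite inE negbK => /eqP.
  by move=> [S LS [[x0 x1] xS]]; exact: realization_face LS x0 x1 xS.
apply: (subclosed_compact _ (@rV_compact R #|E| (fun=> `[0, 1]%classic) _)).
- apply: closed_bigcup; first exact: finite_finset.
  move=> S _; apply: closedI; first apply: closedI.
  + rewrite (_ : mkset _ = \bigcap_e ((fun x => bary x e) @^-1` [set r | 0 <= r])).
      apply: closed_bigI => e _; have /continuous_closedP := cbary e; apply.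
      exact: closed_ge.
    by apply/seteqP; split => x /= h; [move=> e _; exact: h|move=> e; exact: h].
  + have /continuous_closedP := @continuous_sum_fun R V E (index_enum E) xpredT _ cbary.
    by move=> /(_ _ (@closed_eq R 1)).
  + rewrite (_ : mkset _ = \bigcap_(e in [set e | e \notin S])
        ((fun x => bary x e) @^-1` [set r | r = 0])) //.
    apply: closed_bigI => e _; have /continuous_closedP := cbary e; apply.
    exact: closed_eq.
- by move=> _; exact: segment_compact.
- move=> x [S _ [[x0 x1] _]] i /=; rewrite in_itv /=.
  by have := x0 (enum_val i); have := bary_le1 (enum_val i) x0 x1;
    rewrite /bary enum_valK => -> ->.
Qed.

End barycentric.

(** * Collapses *)

Definition deforms (R : realType) (V : topologicalType) (A B : set V) : Prop :=
  B `<=` A /\ exists D : R * V -> V,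
  [/\ continuous D, forall x, D (0, x) = x,
      forall (t : R) x, 0 <= t <= 1 -> A x -> A (D (t, x)),
      forall x, A x -> B (D (1, x))
    & forall t x, B x -> D (t, x) = x].

Lemma deforms_refl (R : realType) (V : topologicalType) (A : set V) :
  deforms R A A.
Proof.
by split=> //; exists snd; split => //; exact: continuous_snd.
Qed.

Lemma deforms_trans (R : realType) (V : topologicalType) (A B C : set V) :
  deforms R A B -> deforms R B C -> deforms R A C.
Proof.
move=> [BA [D [cD D0 DA D1 DB]]] [CB [H [cH H0 HB H1 HC]]].
split; first exact: subset_trans BA.
exists (fun p => H (Num.max 0 (2 * p.1 - 1), D (Num.min 1 (2 * p.1), p.2))).
have c2 : continuous (fun p : R * V => 2 * p.1).
  by apply: continuousM_fun; [exact: cst_continuous|exact: continuous_fst].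
split.
- apply: continuous_compose cH; apply: continuous_pair.
    apply: continuous_max_fun; first exact: cst_continuous.
    by apply: continuousB_fun c2 _; exact: cst_continuous.
  apply: continuous_compose cD; apply: continuous_pair; last exact: continuous_snd.
  by apply: continuous_min_fun c2; exact: cst_continuous.
- move=> x /=; rewrite mulr0.
  have -> : Num.min 1 0 = 0 :> R by apply/min_idPr; lra.
  have -> : Num.max 0 (0 - 1) = 0 :> R by rewrite max_l; lra.
  by rewrite D0 H0.
- move=> t x /andP[t0 t1] Ax /=; have [t2|t2] := lerP 1 (2 * t).
    apply/BA/HB; last exact: D1.
    by rewrite le_max lexx ge_max ler01 /=; lra.
  have -> : Num.max 0 (2 * t - 1) = 0 :> R by rewrite max_l; lra.
  by rewrite H0; apply: DA => //; lra.
- move=> x Ax /=; rewrite mulr1.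
  have -> : Num.min 1 2 = 1 :> R by apply/min_idPl; lra.
  have -> : Num.max 0 (2 - 1) = 1 :> R by rewrite max_r; lra.
  exact/H1/D1.
- by move=> t x Cx /=; rewrite DB; [exact: HC|exact: CB].
Qed.

Section star_collapse.
Variable E : finType.
Implicit Types (L : set {set E}) (s S : {set E}) (v : E).

Definition del_star L s : set {set E} := [set S | L S /\ ~~ (s \subset S)].

Lemma face_closed_del_star L s : face_closed L -> face_closed (del_star L s).
Proof.
move=> fL S S' [LS sS] S'S S'0; split; first exact: fL LS S'S S'0.
by apply: contra sS => /fintype.subset_trans; apply.
Qed.

(* The open star of [s] can then be pushed off towards [v]: an elementary collapse if [v |: s] is the only proper
   coface of [s], a strong collapse if [s] is a vertex. *)
Definition cone_link L s v :=
  [/\ s != finset.set0, v \notin s & forall S, L S -> s \subset S -> L (v |: S)].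

Inductive collapses : set {set E} -> set {set E} -> Prop :=
| collapses_refl L : collapses L L
| collapses_step L L' s v :
    cone_link L s v -> collapses (del_star L s) L' -> collapses L L'.

Variable R : realType.
Local Notation V := 'rV[R]_#|E|.

Lemma sum_indicator (s : {set E}) (c : R) : \sum_e c * (e \in s)%:R = c * #|s|%:R.
Proof.
rewrite -mulr_sumr; congr (_ * _); rewrite -sum1_card natr_sum [RHS]big_mkcond.
by apply: eq_bigr => e _; case: (e \in s).
Qed.

(** The smallest coordinate on [s] is subtracted from every vertex of [s], and the mass so freed,
    [#|s|] times that minimum, is given to [v]. At time 1 some vertex of [s] has lost all its mass,
    so the point has left the open star; a point outside the open star has minimum 0 and never
    moves. *)
Lemma deforms_del_star L s v : face_closed L -> cone_link L s v ->
  deforms R (realization L : set V) (realization (del_star L s)).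
Proof.
move=> fL [s0 vs Lv]; split; first by move=> x [x0 [x1 []]].
pose G (p : R * V) e : R := bary p.2 e +
  p.1 * minb s p.2 * (#|s|%:R * (e \in [set v]%SET)%:R - (e \in s)%:R).
have DL t x : 0 <= t <= 1 -> realization L x -> realization L (bvec (G (t, x))).
  move=> /andP[t0 t1] Lx; have [x0 [x1 LS]] := Lx.
  have m0 := minb_ge0 s x.
  (* Either the point does not move, or its support contains [s] and the cone hypothesis allows [v]
     to be added to it. *)
  have [m_eq0|m_neq0] := eqVneq (minb s x) 0.
    rewrite (_ : bvec _ = x) //; apply: bary_inj => e.
    by rewrite baryE /G /= m_eq0 mulr0 mul0r addr0.
  have m_gt0 : 0 < minb s x by rewrite lt_neqAle eq_sym m_neq0.
  set S := finset _ in LS; have sS : s \subset S.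
    apply/fintype.subsetP => e es; rewrite inE.
    by apply: lt0r_neq0; exact: lt_le_trans m_gt0 (minb_le x0 es).
  apply: (realization_face fL (Lv _ LS sS)).
  - move=> e; rewrite baryE /G /= finset.in_set1.
    have tm0 : 0 <= t * minb s x by exact: mulr_ge0.
    have tm : t * minb s x <= minb s x by rewrite ler_piMl.
    have [->|ev] := eqVneq e v.
      by rewrite (negPf vs) mulr1 subr0; apply: addr_ge0; [exact: x0|exact: mulr_ge0].
    rewrite mulr0 sub0r; case: (boolP (e \in s)) => es.
      by rewrite mulrN1 subr_ge0; apply: le_trans tm _; exact: minb_le es.
    by rewrite oppr0 mulr0 addr0; exact: x0.
  - under eq_bigr do rewrite baryE /G /= mulrBr mulrA -[X in _ - X]mulr1.
    under eq_bigr do rewrite mulr1.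
    rewrite big_split /= x1 sumrB !sum_indicator cards1 mulr1.
    by rewrite subrr addr0.
  - move=> e; rewrite !inE negb_or negbK => /andP[ev /eqP xe].
    rewrite baryE /G /= finset.in_set1 (negPf ev) mulr0 sub0r.
    rewrite /bary xe add0r; have -> : e \in s = false.
      apply/negP => /(fintype.subsetP sS); rewrite inE /bary xe eqxx //.
    by rewrite oppr0 mulr0.
exists (fun p => bvec (G p)); split.
- apply: continuous_bvec => e; apply: continuousD_fun.
    exact (continuous_compose (@continuous_snd R V) (@continuous_bary R E e)).
  apply: continuousM_fun; last exact: cst_continuous.
  apply: continuousM_fun; first exact: continuous_fst.
  exact (continuous_compose (@continuous_snd R V) (@continuous_minb R E s)).
- by move=> x; apply: bary_inj => e; rewrite baryE /G /= !mul0r addr0.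
- exact: DL.
- move=> x Lx; have [|y0 [y1 LS]] := DL 1 x _ Lx; first by rewrite ler01 lexx.
  split=> //; split=> //; split => //.
  have [x0 [x1 _]] := Lx.
  (* The minimising vertex ends with coordinate 0; it differs from [v], so it receives nothing
     back. *)
  have [e es me] := minb_attained s0 x0 (fun e => bary_le1 e x0 x1).
  apply/fintype.subsetPn; exists e => //; rewrite inE negbK; apply/eqP.
  rewrite -/(bary _ _) baryE /G /= finset.in_set1.
  have -> : e == v = false by apply: contraNF vs => /eqP <-.
  by rewrite es -me mulr0 sub0r mul1r mulrN1 subrr.
- move=> t x [x0 [x1 [LS /fintype.subsetPn[e es]]]]; rewrite inE negbK => /eqP xe.
  apply: bary_inj => e'; rewrite baryE /G /=.
  by rewrite (minb_eq0 x0 es xe) mulr0 mul0r addr0.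
Qed.

Lemma collapses_deforms L L' : face_closed L -> collapses L L' ->
  face_closed L' /\ deforms R (realization L : set V) (realization L').
Proof.
move=> + LL'; elim: LL' => {L L'} [L|L L' s v cl _ IH] fL.
  by split => //; exact: deforms_refl.
have [fL' dL'] := IH (face_closed_del_star fL); split => //.
exact: deforms_trans (deforms_del_star fL cl) dL'.
Qed.

End star_collapse.

(** * Crushing the complement of a family of facets *)

Section facets.
Variables (R : realType) (E I : finType) (L : set {set E}) (d : I -> nat).
Variable sig : I -> {set E}.
Local Notation V := 'rV[R]_#|E|.
Hypothesis fL : face_closed L.
Hypothesis sigL : forall i, L (sig i).
Hypothesis card_sig : forall i, #|sig i| = (d i).+1.
Hypothesis sig_facet : forall i S, L S -> sig i \subset S -> S = sig i.
Hypothesis sig_inj : injective sig.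

(** Only the facets go, their boundaries stay. Maximality makes the rest a subcomplex, whose
    realization misses exactly the open facets. *)
Definition del_facets : set {set E} := [set S | L S /\ forall i, S <> sig i].
Local Notation C := del_facets.

Lemma face_closed_del_facets : face_closed C.
Proof.
move=> S S' [LS Ssig] S'S S'0; split; first exact: fL LS S'S S'0.
move=> i S'i; apply: (Ssig i); apply: sig_facet => //.
by rewrite -S'i.
Qed.

Local Notation m i x := (minb (sig i) x).
Local Notation k i := ((d i).+1%:R : R).

Lemma sig_neq0 i : sig i != finset.set0.
Proof. by rewrite -card_gt0 card_sig. Qed.

Lemma minb_gt0_supp i (x : V) : realization L x -> 0 < m i x ->
  finset (fun e => x ord0 (enum_rank e) != 0) = sig i.
Proof.
move=> [x0 [x1 LS]] m_gt0; apply: sig_facet => //.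
apply/fintype.subsetP => e es; rewrite inE.
by apply: lt0r_neq0; exact: lt_le_trans m_gt0 (minb_le x0 es).
Qed.

Lemma minb_gt0_out i e (x : V) : realization L x -> 0 < m i x -> e \notin sig i ->
  bary x e = 0.
Proof.
by move=> Lx mx; rewrite -(minb_gt0_supp Lx mx) inE negbK => /eqP.
Qed.

Lemma minb_gt0_unique i j (x : V) : realization L x -> 0 < m i x -> j != i ->
  m j x = 0.
Proof.
move=> Lx mi ji; have [x0 _] := Lx.
have := minb_ge0 (sig j) x; rewrite le_eqVlt => /orP[/eqP //|mj].
by move: ji; rewrite (sig_inj (etrans (esym (minb_gt0_supp Lx mj)) (minb_gt0_supp Lx mi))) eqxx.
Qed.

Lemma realization_del_facetsP (x : V) :
  realization C x <-> realization L x /\ forall i, m i x = 0.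
Proof.
split=> [[x0 [x1 [LS Ssig]]]|[[x0 [x1 LS]] mx]].
  have Lx : realization L x by [].
  split=> // i; have := minb_ge0 (sig i) x; rewrite le_eqVlt => /orP[/eqP //|mi].
  by case: (Ssig i); exact: minb_gt0_supp.
split=> //; split=> //; split=> // i Si.
have [e es me] := minb_attained (sig_neq0 i) x0 (fun e => bary_le1 e x0 x1).
by move: es; rewrite -Si inE -/(bary _ _) -me mx eqxx.
Qed.

(** The quantity [k i * m i x] is the height over the boundary of the facet, normalised to be 1 at
    the barycentre. *)
Lemma facet_minb_sum i (x : V) : realization L x ->
  k i * m i x <= \sum_(e in sig i) bary x e <= 1.
Proof.
move=> [x0 [x1 _]]; apply/andP; split.
  rewrite -card_sig mulrC mulr_natr -sumr_const; apply: ler_sum => e; exact: minb_le.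
by rewrite -x1 [leRHS](bigID (mem (sig i))) /= lerDl sumr_ge0.
Qed.

Variant facet_spec (x : V) : Prop :=
| InDel of realization C x & (forall i, m i x = 0)
| InFacet i of 0 < m i x & (forall j, j != i -> m j x = 0)
    & (forall e, e \notin sig i -> bary x e = 0).

Lemma facetP (x : V) : realization L x -> facet_spec x.
Proof.
move=> Lx; have [i mi|m0] := pickP (fun i => 0 < m i x).
  apply: (@InFacet _ i) => // [j|e]; first exact: minb_gt0_unique.
  exact: minb_gt0_out.
have {}m0 i : m i x = 0.
  apply/eqP; have := minb_ge0 (sig i) x; rewrite le_eqVlt m0 orbF.
  by rewrite eq_sym.
by apply: InDel => //; apply/realization_del_facetsP.
Qed.

Section extend.
Variable H : R * V -> V.
Hypothesis contH : continuous H.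
Hypothesis H0 : forall x, H (0, x) = x.
Hypothesis HC : forall (t : R) x, 0 <= t <= 1 -> realization C x -> realization C (H (t, x)).

(** On the realization at most one summand is nonzero, so these sums give one formula for all
    facets. In a facet, [M x] is the normalised height and [B x] is [M x] times the barycentre,
    hence [rh] is the radial projection to the boundary wherever [M x] is at most 1/2. The clipping
    at 1/2 keeps the denominators positive everywhere; [tau] needs no larger value, as time stops at
    1. *)
Let M (x : V) := \sum_i k i * m i x.
Let B (x : V) e := \sum_i m i x * (e \in sig i)%:R.
Let rh (x : V) e := (bary x e - B x e) / (1 - Num.min (M x) 2^-1).
Let tau (t : R) := Num.min (t / 2) 2^-1.

(* Radial retraction of each open facet from its barycentre: up to time [t] the collar [M x <= t / 2] is swept by
   the homotopy on the rest, and the remaining inner simplex is dilated to the whole facet. The summand [H - rh]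
   vanishes outside the collar. *)
Definition facet_extension (p : R * V) : V := bvec (fun e =>
  bary (H (Num.max 0 (p.1 - 2 * M p.2), bvec (rh p.2))) e - rh p.2 e
  + (bary p.2 e - B p.2 e) / (1 - Num.min (M p.2) (tau p.1))
  + \sum_i Num.max 0 (m i p.2 - tau p.1 / k i) / (1 - tau p.1) * (e \in sig i)%:R).
Local Notation Ht := facet_extension.

Lemma continuous_facet_extension : continuous Ht.
Proof.
have c2 (U : topologicalType) (g : V -> U) : continuous g -> continuous (fun p : R * V => g p.2).
  by move=> cg; exact (continuous_compose (@continuous_snd R V) cg).
have ccst (c : R) (U : topologicalType) : continuous (fun _ : U => c) by exact: cst_continuous.
have cm i : continuous (fun x : V => m i x) by exact: continuous_minb.
have cM : continuous M.
  by apply: continuous_sum_fun => i; apply: continuousM_fun.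
have cB e : continuous (fun x => B x e).
  by apply: continuous_sum_fun => i; apply: continuousM_fun.
have ctau : continuous (fun p : R * V => tau p.1).
  apply: continuous_min_fun => //; apply: continuousM_fun => //.
  exact: continuous_fst.
have cnum e : continuous (fun x => bary x e - B x e).
  by apply: continuousB_fun => //; exact: continuous_bary.
have crh e : continuous (fun x => rh x e).
  apply: continuousM_fun => //; apply: continuousV_fun.
    by apply: continuousB_fun => //; exact: continuous_min_fun.
  by move=> x; apply: lt0r_neq0; rewrite subr_gt0 gt_min; apply/orP; right; lra.
apply: continuous_bvec => e; apply: continuousD_fun; first apply: continuousD_fun.
- apply: continuousB_fun; last exact: (c2 _ _ (crh e)).
  apply: (continuous_compose _ (@continuous_bary R E e)).
  apply: continuous_compose contH; apply: continuous_pair.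
    apply: continuous_max_fun => //; apply: continuousB_fun.
      exact: continuous_fst.
    by apply: continuousM_fun => //; exact: c2.
  by apply: (c2 _ (fun x => bvec (rh x))); apply: continuous_bvec.
- apply: continuousM_fun; first exact: (c2 _ _ (cnum e)).
  apply: continuousV_fun.
    apply: continuousB_fun => //; apply: continuous_min_fun => //.
    exact: c2.
  move=> p; apply: lt0r_neq0; rewrite subr_gt0 gt_min; apply/orP; right.
  by rewrite /tau gt_min; apply/orP; right; lra.
- apply: continuous_sum_fun => i; apply: continuousM_fun => //.
  apply: continuousM_fun.
    apply: continuous_max_fun => //; apply: continuousB_fun.
      exact: (c2 _ _ (cm i)).
    exact: continuousM_fun.
  apply: continuousV_fun; first exact: continuousB_fun.
  move=> p; apply: lt0r_neq0; rewrite subr_gt0.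
  by rewrite /tau gt_min; apply/orP; right; lra.
Qed.

Lemma facet_extension_del t x : 0 <= t -> realization C x -> Ht (t, x) = H (t, x).
Proof.
move=> t0 /realization_del_facetsP[Lx mx].
have M0 : M x = 0 by rewrite /M big1 // => i _; rewrite mx mulr0.
have B0 e : B x e = 0 by rewrite /B big1 // => i _; rewrite mx mul0r.
have tau0 : 0 <= tau t by rewrite /tau le_min; apply/andP; split; lra.
have rhE : bvec (rh x) = x.
  apply: bary_inj => e; rewrite baryE /rh M0 B0 min_l; last by lra.
  by rewrite !subr0 divr1.
apply: bary_inj => e; rewrite /Ht baryE /= rhE M0 B0 mulr0 subr0.
rewrite -[rh x e]baryE rhE max_r // min_l // !subr0 divr1 subrK.
rewrite big1 ?addr0 // => i _; rewrite mx sub0r max_l ?mul0r //.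
by rewrite oppr_le0 divr_ge0.
Qed.

Lemma facet_extension_realization t x : 0 <= t <= 1 -> realization L x ->
  realization L (Ht (t, x)).
Proof.
move=> /andP[t0 t1] Lx; have [x0 [x1 LS]] := Lx; case: (facetP Lx) => [Cx mx|i mi mj out].
  rewrite facet_extension_del //.
  have Ct : realization C (H (t, x)) by apply: HC => //; rewrite t0 t1.
  by have [] := (realization_del_facetsP _).1 Ct.
have M_E : M x = k i * m i x.
  by rewrite /M (bigD1 i) //= big1 ?addr0 // => j ji; rewrite mj // mulr0.
have B_E e : B x e = m i x * (e \in sig i)%:R.
  by rewrite /B (bigD1 i) //= big1 ?addr0 // => j ji; rewrite mj // mul0r.
have k0 : 0 < k i by rewrite ltr0n.
have tauE : tau t = t / 2 by rewrite /tau min_l //; lra.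
have M1 : M x <= 1 by have /andP[a b] := facet_minb_sum i Lx; rewrite M_E; exact: le_trans a b.
have Mpos : 0 < M x by rewrite M_E mulr_gt0.
have num0 e : 0 <= bary x e - B x e.
  rewrite B_E; case: (boolP (e \in sig i)) => es; last by rewrite mulr0 subr0; exact: x0.
  by rewrite mulr1 subr_ge0; exact: minb_le.
have sumnum : \sum_e (bary x e - B x e) = 1 - M x.
  rewrite sumrB x1; congr (_ - _); under eq_bigr do rewrite B_E.
  by rewrite sum_indicator card_sig mulrC M_E.
have numout e : e \notin sig i -> bary x e - B x e = 0.
  by move=> es; rewrite out // B_E (negPf es) mulr0 subrr.
have sumE e : \sum_j Num.max 0 (m j x - tau t / k j) / (1 - tau t) * (e \in sig j)%:R
    = Num.max 0 (m i x - tau t / k i) / (1 - tau t) * (e \in sig i)%:R.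
  rewrite (bigD1 i) //= big1 ?addr0 // => j ji; rewrite mj // max_l ?mul0r //.
  by rewrite sub0r oppr_le0 divr_ge0 // tauE; lra.
(* In the collar the projected point [rh x] lies on the boundary of the facet, hence in [C], and the
   formula reduces to [H] applied to it. *)
have [Mt|Mt] := lerP (M x) (t / 2).
  have Cr : realization C (bvec (rh x)).
    have rh0 : 0 < 1 - M x by lra.
    have rhx e : rh x e = (bary x e - B x e) / (1 - M x).
      by rewrite /rh min_l //; lra.
    have Lr : realization L (bvec (rh x)).
      apply: (realization_face fL (sigL i)) => [e||e es]; rewrite ?baryE ?rhx.
      - by rewrite divr_ge0 // ltW.
      - under eq_bigr do rewrite baryE rhx.
        by rewrite -mulr_suml sumnum divff // gt_eqF.
      - by rewrite numout // mul0r.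
    (* In facet [i] the minimising vertex has lost all its mass. A positive height over another
       facet would put that facet inside facet [i], against maximality. *)
    apply/realization_del_facetsP; split => // j.
    have [-> |ji] := eqVneq j i.
      have [e es me] := minb_attained (sig_neq0 i) x0 (fun e => bary_le1 e x0 x1).
      apply: (minb_eq0 (proj1 Lr) es).
      by rewrite baryE rhx B_E es mulr1 me subrr mul0r.
    apply/eqP; apply: contraT => mj0.
    have {}mj0 : 0 < m j (bvec (rh x)) by rewrite lt_neqAle eq_sym mj0 minb_ge0.
    have sji : sig j \subset sig i.
      apply/fintype.subsetP => e es; apply: contraT => ei.
      have := lt_le_trans mj0 (minb_le (proj1 Lr) es).
      by rewrite baryE rhx numout // mul0r ltxx.
    by move: ji; rewrite (sig_inj (sig_facet (sigL i) sji)) eqxx.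
  have s01 : 0 <= Num.max 0 (t - 2 * M x) <= 1.
    by rewrite le_max lexx ge_max ler01 /=; lra.
  rewrite (_ : Ht (t, x) = H (Num.max 0 (t - 2 * M x), bvec (rh x))).
    by have [] := (realization_del_facetsP _).1 (HC s01 Cr).
  apply: bary_inj => e; rewrite /Ht baryE /= sumE.
  rewrite [rh x e]/rh !min_l; [|by rewrite tauE|by lra].
  have mneg : m i x - tau t / k i <= 0.
    by rewrite subr_le0 ler_pdivlMr // tauE mulrC -M_E.
  by rewrite subrK (max_l mneg) !mul0r addr0.
(* Beyond the collar [H] is taken at time 0 and cancels [rh]. What remains is the dilation from the
   barycentre, with new height [(M x - t / 2) / (1 - t / 2)]. *)
have mt : 0 <= m i x - t / 2 / k i.
  by rewrite subr_ge0 ler_pdivrMr // [leRHS]mulrC -M_E ltW.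
have HtE e : bary (Ht (t, x)) e = (bary x e - B x e) / (1 - t / 2)
    + (m i x - t / 2 / k i) / (1 - t / 2) * (e \in sig i)%:R.
  rewrite /Ht baryE /= sumE max_l; last by lra.
  rewrite H0 baryE subrr add0r min_r ?tauE; last by lra.
  by rewrite max_r.
have den : 0 < 1 - t / 2 by lra.
apply: (realization_face fL (sigL i)) => [e||e es]; rewrite ?HtE.
- by apply: addr_ge0; [exact: divr_ge0 (num0 e) (ltW den)|apply: mulr_ge0 => //; exact: divr_ge0 mt (ltW den)].
- under eq_bigr do rewrite HtE.
  rewrite big_split /= -mulr_suml sumnum sum_indicator card_sig.
  rewrite mulrAC -mulrDl mulrBl (mulrC _ (k i)) -M_E divfK; last by rewrite gt_eqF.
  by rewrite addrA subrK divff // gt_eqF.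
- by rewrite numout // (negPf es) mulr0 mul0r addr0.
Qed.

Lemma facet_extension0 x : Ht (0, x) = x.
Proof.
have M0 : 0 <= M x by apply: sumr_ge0 => i _; exact: mulr_ge0 (minb_ge0 _ _).
have tau0 : tau 0 = 0 by rewrite /tau mul0r min_l //; lra.
apply: bary_inj => e; rewrite /Ht baryE /= tau0 max_l; last by lra.
rewrite H0 baryE subrr add0r min_r // subr0 divr1 -[RHS](subrK (B x e)).
congr (_ + _); apply: eq_bigr => i _.
by rewrite mul0r subr0 divr1 max_r // minb_ge0.
Qed.

End extend.
End facets.

(** * Facets modulo their boundaries as spheres *)

Lemma wedge_lift_eq (I : choiceType) (X : I -> topologicalType) (p0 : forall i, X i)
    i j (a : X i) (b : X j) :
  wedge_lift p0 a = wedge_lift p0 b ->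
  existT X i a = existT X j b \/ a = p0 i /\ b = p0 j.
Proof.
by move=> /eqmodP/predU1P[|/andP[/eqP/= -> /eqP/= ->]]; [left|right].
Qed.

(* Inverse stereographic projection of [z / m], where [m] is the normalised distance to the boundary of the facet
   and [z] its affine coordinates from the 0-th vertex; [Q] is [|z|^2] on the facet and keeps the denominator
   positive away from it. *)
Section facet_sphere.
Variables (R : realType) (E : finType) (n : nat) (vert : 'I_n.+1 -> E).
Hypothesis vert_inj : injective vert.
Local Notation V := 'rV[R]_#|E|.
Local Notation sig := [set vert j | j : 'I_n.+1]%SET.
Implicit Type x : V.

Definition facet_height x : R := n.+1%:R * minb sig x.
Definition facet_coord x j : R := bary x (vert j) - bary x (vert ord0).
Definition facet_sqnorm x : R :=
  \sum_j facet_coord x j ^+ 2 + (1 - \sum_j bary x (vert j)) ^+ 2.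
Definition stereo_row x : 'rV[R]_n.+1 := \row_j
  ((if j == ord0 then facet_sqnorm x - facet_height x ^+ 2
    else 2 * facet_height x * facet_coord x j)
   / (facet_sqnorm x + facet_height x ^+ 2)).
Local Notation mm := facet_height.
Local Notation z := facet_coord.
Local Notation Q := facet_sqnorm.

Lemma sum_facet x : \sum_(e in sig) bary x e = \sum_j bary x (vert j).
Proof. by rewrite big_imset //= => i j _ _; exact: vert_inj. Qed.

Lemma card_facet : #|sig| = n.+1.
Proof. by rewrite card_imset // card_ord. Qed.

Lemma facet_height_ge0 x : 0 <= mm x.
Proof. by rewrite mulr_ge0 // minb_ge0. Qed.

Lemma facet_sqnorm_ge0 x : 0 <= Q x.
Proof. by rewrite addr_ge0 // ?sqr_ge0 // sumr_ge0 // => j _; rewrite sqr_ge0. Qed.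

Lemma facet_coord0 x : z x ord0 = 0. Proof. exact: subrr. Qed.

Section point.
Variables (x : V).
Hypothesis (x0 : forall e, 0 <= bary x e) (x1 : \sum_e bary x e = 1).

Lemma facet_height_attained : exists j, mm x = n.+1%:R * bary x (vert j).
Proof.
have s0 : sig != finset.set0 by rewrite -card_gt0 card_facet.
have [e /imsetP[j _ ->] me] := minb_attained s0 x0 (fun e => bary_le1 e x0 x1).
by exists j; rewrite /mm me.
Qed.

Lemma facet_height_le j : mm x <= n.+1%:R * bary x (vert j).
Proof. by rewrite ler_pM2l ?ltr0n // minb_le // imset_f. Qed.

(** If both terms vanish, the coordinates on the facet are all equal and sum to 1, while their
    minimum is 0. *)
Lemma stereo_den_gt0 : 0 < Q x + mm x ^+ 2.
Proof.
rewrite lt_neqAle addr_ge0 ?sqr_ge0 ?facet_sqnorm_ge0 // andbT eq_sym.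
apply/eqP => /eqP; rewrite paddr_eq0 ?sqr_ge0 ?facet_sqnorm_ge0 //.
rewrite sqrf_eq0 => /andP[Q0 /eqP m0]; move: Q0.
rewrite paddr_eq0 ?sqr_ge0 //; last by apply: sumr_ge0 => j _; exact: sqr_ge0.
rewrite psumr_eq0; last by move=> j _; exact: sqr_ge0.
move=> /andP[/allP zj]; rewrite sqrf_eq0 subr_eq0 => /eqP s1.
have xv j : bary x (vert j) = bary x (vert ord0).
  by apply/eqP; rewrite -subr_eq0 -(sqrf_eq0 (_ - _)); apply: zj; rewrite mem_index_enum.
have [j] := facet_height_attained; rewrite m0 xv => /esym/eqP.
rewrite mulf_eq0 pnatr_eq0 /= => /eqP v0.
by move: s1; rewrite big1 => [/eqP|j' _]; [rewrite oner_eq0|rewrite xv].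
Qed.

Lemma stereo_row0 : stereo_row x ord0 ord0 = 1 <-> mm x = 0.
Proof.
have den := lt0r_neq0 stereo_den_gt0; rewrite mxE eqxx; split=> [h|m0].
  have : Q x - mm x ^+ 2 = Q x + mm x ^+ 2 by rewrite -[LHS](divfK den) h mul1r.
  by move=> {}h; apply/eqP; rewrite -sqrf_eq0; apply/eqP; lra.
by move: den; rewrite m0 expr0n /= subr0 addr0 => /divff.
Qed.

Lemma stereo_row_boundary : mm x = 0 -> stereo_row x = sphere_base_vec R n.
Proof.
move=> m0; apply/rowP => j; rewrite [RHS]mxE; case: eqP => [->|/eqP j0].
  exact/stereo_row0.
by rewrite mxE (negPf j0) m0 mulr0 !mul0r.
Qed.

(** Where the height is positive, the assumption removes the correction term of [Q], and the usual
    identity for inverse stereographic projection applies; where it is 0, the value is the pole. *)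
Lemma stereo_row_sphere :
  (0 < mm x -> \sum_j bary x (vert j) = 1) -> sphere (stereo_row x).
Proof.
move=> s1; have := facet_height_ge0 x; rewrite le_eqVlt => /orP[/eqP m0|mpos].
  by rewrite stereo_row_boundary //; exact: sphere_base_in.
have den := lt0r_neq0 stereo_den_gt0.
have QE : Q x = \sum_j z x j ^+ 2 by rewrite /Q (s1 mpos) subrr expr0n addr0.
rewrite /sphere /= (bigD1 ord0) //= mxE eqxx.
rewrite (eq_bigr (fun j => (2 * mm x / (Q x + mm x ^+ 2)) ^+ 2 * z x j ^+ 2)); last first.
  by move=> j j0; rewrite mxE (negPf j0) -exprMn [in RHS]mulrAC.
rewrite -mulr_sumr.
have -> : \sum_(j < n.+1 | j != ord0) z x j ^+ 2 = Q x.
  by rewrite QE [RHS](bigD1 ord0) //= facet_coord0 expr0n add0r.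
by field.
Qed.

End point.

(** The sphere point determines the quotient of [z] by the height ([hz]). Proportional [z] attain
    their minimum at the same vertex [j], and total mass 1 then fixes the scale, that is the height
    itself. *)
Lemma stereo_row_inj x y :
  (forall e, 0 <= bary x e) -> \sum_e bary x e = 1 ->
  (forall e, 0 <= bary y e) -> \sum_e bary y e = 1 ->
  0 < mm x -> 0 < mm y -> \sum_j bary x (vert j) = 1 -> \sum_j bary y (vert j) = 1 ->
  stereo_row x = stereo_row y -> forall j, bary x (vert j) = bary y (vert j).
Proof.
move=> x0 x1 y0 y1 mx my sx sy /rowP xy.
have Dx := lt0r_neq0 (stereo_den_gt0 x0 x1).
have Dy := lt0r_neq0 (stereo_den_gt0 y0 y1).
have h0 : (Q x - mm x ^+ 2) * (Q y + mm y ^+ 2) = (Q y - mm y ^+ 2) * (Q x + mm x ^+ 2).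
  by have /eqP := xy ord0; rewrite !mxE eqxx eqr_div // => /eqP.
have hQ : (Q x + mm x ^+ 2) * mm y ^+ 2 = (Q y + mm y ^+ 2) * mm x ^+ 2 by lra.
have hz j : z x j * mm y = z y j * mm x.
  have [->|j0] := eqVneq j ord0; first by rewrite !facet_coord0 !mul0r.
  have /eqP : 2 * mm x * z x j / (Q x + mm x ^+ 2) = 2 * mm y * z y j / (Q y + mm y ^+ 2).
    by have := xy j; rewrite !mxE (negPf j0).
  rewrite eqr_div // => /eqP h.
  have nz : 2 * mm x * mm y * (Q y + mm y ^+ 2) != 0.
    apply: mulf_neq0 _ Dy; apply: mulf_neq0 _ (lt0r_neq0 my).
    by apply: mulf_neq0 _ (lt0r_neq0 mx); rewrite pnatr_eq0.
  apply: (mulfI nz).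
  transitivity (2 * mm x * z x j * (Q y + mm y ^+ 2) * mm y ^+ 2); first by ring.
  rewrite h.
  transitivity (2 * mm y * z y j * ((Q x + mm x ^+ 2) * mm y ^+ 2)); first by ring.
  by rewrite hQ; ring.
have [j xj] := facet_height_attained x0 x1.
have n0 : 0 < n.+1%:R :> R by rewrite ltr0n.
have zx l : z x j <= z x l.
  rewrite lerD2r -(ler_pM2l n0) -xj; exact: facet_height_le.
have zy l : z y j <= z y l by rewrite -(ler_pM2r mx) -!hz ler_pM2r.
have [l yl] := facet_height_attained y0 y1.
have yj : mm y = n.+1%:R * bary y (vert j).
  apply/le_anti; rewrite facet_height_le //= yl ler_pM2l //.
  by have := zy l; rewrite lerD2r.
(* Each coordinate is the minimum plus its excess [z w i - z w j] over it, and the minima add up to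
   the height. *)
have decomp w : \sum_i bary w (vert i) = 1 -> mm w = n.+1%:R * bary w (vert j) ->
    mm w + \sum_i (z w i - z w j) = 1.
  move=> s1 ->; rewrite -[RHS]s1.
  have -> c : n.+1%:R * c = \sum_(i < n.+1) c :> R by rewrite sumr_const card_ord mulr_natl.
  rewrite -big_split /=.
  by apply: eq_bigr => i _; rewrite /z; ring.
have hx := decomp x sx xj; have hy := decomp y sy yj.
have exy : mm x = mm y.
  have e1 : mm y = mm x * mm y + \sum_i (z x i - z x j) * mm y.
    by rewrite -mulr_suml -mulrDl hx mul1r.
  have e2 : mm x = mm y * mm x + \sum_i (z y i - z y j) * mm x.
    by rewrite -mulr_suml -mulrDl hy mul1r.
  rewrite [LHS]e2 [RHS]e1 mulrC; congr (_ + _); apply: eq_bigr => i _.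
  by rewrite [LHS]mulrBl [RHS]mulrBl !hz.
have ez i : z x i = z y i.
  by apply: (mulIf (lt0r_neq0 mx)); rewrite -hz exy.
have ej : bary x (vert j) = bary y (vert j).
  by apply: (mulfI (lt0r_neq0 n0)); rewrite -xj -yj.
move=> i; have := ez i; have := ez j; rewrite /z ej => h1 h2.
by move: h1 h2; lra.
Qed.

Lemma stereo_row_surj (a : 'rV[R]_n.+1) : sphere a -> a != sphere_base_vec R n ->
  exists x, [/\ forall e, 0 <= bary x e, \sum_e bary x e = 1,
    forall e, e \notin sig -> bary x e = 0 & stereo_row x = a].
Proof.
rewrite /sphere /= (bigD1 ord0) //= => sa ab.
set a0 := a ord0 ord0 in sa.
have a0_lt1 : a0 < 1.
  have rest0 : 0 <= \sum_(i < n.+1 | i != ord0) a ord0 i ^+ 2.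
    by apply: sumr_ge0 => i _; exact: sqr_ge0.
  rewrite ltNge; apply: contra ab => a0_ge1.
  have a01 : a0 = 1 by nra.
  have /eqP : \sum_(i < n.+1 | i != ord0) a ord0 i ^+ 2 = 0 by move: sa; rewrite a01; lra.
  rewrite psumr_eq0 => [/allP ai|i _]; last exact: sqr_ge0.
  apply/eqP/rowP => i; rewrite mxE; case: eqP => [->//|/eqP i0].
  by have := ai i (mem_index_enum _); rewrite i0 sqrf_eq0 => /eqP.
(* Stereographic projection from the base point; slot 0 is free because [z] vanishes there. *)
pose w (j : 'I_n.+1) := if j == ord0 then 0 else a ord0 j / (1 - a0).
(* The default 0 is the value of [w] at [ord0], so [mn] is a minimum actually attained. *)
pose mn := \big[Num.min/0]_j w j.
have mnw j : mn <= w j by exact: bigmin_le_cond.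
have [j1 mn1] : exists j, mn = w j.
  have [j _ minj] := Order.TotalTheory.arg_minP w (erefl : xpredT (ord0 : 'I_n.+1)).
  exists j; apply/le_anti; rewrite mnw /=; apply: le_bigmin => [|i _]; last exact: minj.
  by have := minj ord0 erefl; rewrite {2}/w eqxx.
pose k : R := n.+1%:R; have k0 : 0 < k by rewrite ltr0n.
(* The only height compatible with total mass 1: coordinate [j] must be [mu] times
   [k^-1 + (w j - mn)], so that [z] becomes [mu * w j]. *)
pose mu := (1 + \sum_j (w j - mn))^-1.
have den0 : 0 < 1 + \sum_j (w j - mn).
  by rewrite ltr_wpDr ?ltr01 // sumr_ge0 // => j _; rewrite subr_ge0.
have mu0 : 0 < mu by rewrite invr_gt0.
pose g e := \sum_j mu * (k^-1 + (w j - mn)) * (e == vert j)%:R.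
pose x : V := bvec g.
have xv j : bary x (vert j) = mu * (k^-1 + (w j - mn)).
  rewrite baryE /g (bigD1 j) //= eqxx mulr1 big1 ?addr0 // => i ij.
  by rewrite (inj_eq vert_inj) eq_sym (negPf ij) mulr0.
have xout e : e \notin sig -> bary x e = 0.
  move=> es; rewrite baryE /g big1 // => j _; case: eqP => [ej|_]; last by rewrite mulr0.
  by move: es; rewrite ej imset_f.
have kV0 : 0 < k^-1 by rewrite invr_gt0.
have x0 e : 0 <= bary x e.
  case: (boolP (e \in sig)) => [/imsetP[j _ ->]|/xout -> //].
  by rewrite xv; apply/mulr_ge0/addr_ge0; rewrite ?subr_ge0 // ltW.
have sx : \sum_j bary x (vert j) = 1.
  under eq_bigr do rewrite xv.
  rewrite -mulr_sumr big_split /= sumr_const card_ord -mulr_natl divff ?gt_eqF //.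
  by rewrite mulVf // gt_eqF.
have x1 : \sum_e bary x e = 1.
  rewrite (bigID (mem sig)) /= sum_facet sx big1 ?addr0 //.
have mE : mm x = mu.
  have [j xj] := facet_height_attained x0 x1.
  apply/le_anti; apply/andP; split.
    apply: le_trans (facet_height_le x0 j1) _.
    by rewrite xv mn1 subrr addr0 mulrCA divff ?mulr1 // gt_eqF.
  rewrite xj xv mulrCA mulrDr divff ?gt_eqF // ler_pMr // lerDl.
  by rewrite mulr_ge0 ?subr_ge0 // ltW.
have zE j : z x j = mu * w j.
  by rewrite /z !xv {2}/w eqxx; ring.
have QE : Q x = mu ^+ 2 * \sum_j w j ^+ 2.
  rewrite /Q sx subrr expr0n addr0 mulr_sumr; apply: eq_bigr => j _.
  by rewrite zE exprMn.
have a0' : 1 - a0 != 0 by rewrite subr_eq0 eq_sym lt_eqF.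
have wsq : \sum_j w j ^+ 2 = (1 + a0) / (1 - a0).
  rewrite (bigD1 ord0) //= {1}/w eqxx expr0n add0r.
  under eq_bigr => j j0 do rewrite /w (negPf j0) exprMn.
  rewrite -mulr_suml (_ : \sum_(_ < _ | _) _ = 1 - a0 ^+ 2); last by lra.
  by field.
exists x; split => //; apply/rowP => j; rewrite mxE QE mE zE wsq.
have mu0' := lt0r_neq0 mu0.
have dn : mu ^+ 2 * ((1 + a0) / (1 - a0)) + mu ^+ 2 = mu ^+ 2 * (2 / (1 - a0)) by field.
rewrite dn; case: eqP => [->|/eqP j0].
  by rewrite -/a0; field; rewrite a0' mu0'.
by rewrite /w (negPf j0); field; rewrite a0' mu0'.
Qed.

End facet_sphere.

Section facet_wedge.
Variables (R : realType) (E I : finType) (L : set {set E}) (d : I -> nat).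
Variable vert : forall i, 'I_(d i).+1 -> E.
Local Notation V := 'rV[R]_#|E|.
Definition facet_of i := [set vert j | j : 'I_(d i).+1]%SET.
Local Notation sig := facet_of.
Hypothesis fL : face_closed L.
Hypothesis sigL : forall i, L (sig i).
Hypothesis vert_inj : forall i, injective (@vert i).
Hypothesis sig_facet : forall i S, L S -> sig i \subset S -> S = sig i.
Hypothesis sig_inj : injective sig.
Variable i0 : I.

Local Notation X := (set_type (realization L : set V)).
Local Notation sph i := (set_type (@sphere R (d i)) : topologicalType).
Local Notation W := (@wedge I (fun i => sph i) (fun i => @sphere_base R (d i))).
Local Notation lift := (@wedge_lift I (fun i => sph i) (fun i => @sphere_base R (d i))).
Local Notation m i x := (minb (sig i) (set_val x)).
Implicit Type x y : X.

Let card_sig i : #|sig i| = (d i).+1. Proof. exact: card_facet. Qed.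
Let xL x : realization L (set_val x). Proof. exact: set_valP. Qed.
Let x0 x : forall e, 0 <= bary (set_val x) e. Proof. by have [] := xL x. Qed.
Let x1 x : \sum_e bary (set_val x) e = 1. Proof. by have [_ []] := xL x. Qed.

Lemma facet_height_gt0 i x : (0 < facet_height (@vert i) (set_val x)) = (0 < m i x).
Proof. by rewrite pmulr_rgt0 // ltr0n. Qed.

Lemma facet_height_eq0 i x : (facet_height (@vert i) (set_val x) = 0) <-> m i x = 0.
Proof.
split=> [/eqP|mx]; last by rewrite /facet_height -/(sig i) mx mulr0.
by rewrite mulf_eq0 pnatr_eq0 => /eqP.
Qed.

Let sum_vert i x : 0 < m i x -> \sum_j bary (set_val x) (@vert i j) = 1.
Proof.
move=> mx; rewrite -(sum_facet (@vert_inj i)) -(x1 x) [RHS](bigID (mem (sig i))) /=.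
rewrite [X in _ = _ + X]big1 ?addr0 // => e es.
by apply: (minb_gt0_out sig_facet (xL x) mx).
Qed.

Let phi_sphere i x : sphere (stereo_row (@vert i) (set_val x)).
Proof.
apply: (stereo_row_sphere (@vert_inj i) (x0 x) (x1 x)).
by rewrite facet_height_gt0; exact: sum_vert.
Qed.

Definition facet_stereo i x : sph i :=
  exist (fun v => v \in @sphere R (d i)) _ (mem_set (phi_sphere i x)).
Local Notation phi := facet_stereo.

Lemma continuous_facet_stereo i : continuous (phi i).
Proof.
apply: continuous_to_set_type.
rewrite (_ : (fun _ => _) = fun x => stereo_row (@vert i) (set_val x)) //.
have cb e : continuous (fun x => bary (set_val x) e).
  exact (continuous_compose (@set_val_continuous _ _) (@continuous_bary R E e)).
have cm : continuous (fun x => facet_height (@vert i) (set_val x)).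
  apply: continuousM_fun; first exact: cst_continuous.
  exact (continuous_compose (@set_val_continuous _ _) (@continuous_minb R E (sig i))).
have csq (g : X -> R) : continuous g -> continuous (fun x => g x ^+ 2).
  by move=> cg; exact: continuousM_fun.
have cz j : continuous (fun x => facet_coord (@vert i) (set_val x) j).
  by apply: continuousB_fun.
have cQ : continuous (fun x => facet_sqnorm (@vert i) (set_val x)).
  apply: continuousD_fun; first by apply: continuous_sum_fun => j; exact: csq.
  apply: csq; apply: continuousB_fun; first exact: cst_continuous.
  exact: continuous_sum_fun.
apply: continuous_row => j.
rewrite (_ : (fun _ => _) = fun x =>
  (if j == ord0 then facet_sqnorm (@vert i) (set_val x) - facet_height (@vert i) (set_val x) ^+ 2
    else 2 * facet_height (@vert i) (set_val x) * facet_coord (@vert i) (set_val x) j)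
   / (facet_sqnorm (@vert i) (set_val x) + facet_height (@vert i) (set_val x) ^+ 2)); last first.
  by apply/funext => x; rewrite mxE.
apply: continuousM_fun.
  case: (j == ord0); first by apply: continuousB_fun => //; exact: csq.
  by apply: continuousM_fun => //; apply: continuousM_fun => //; exact: cst_continuous.
apply: continuousV_fun; first by apply: continuousD_fun => //; exact: csq.
by move=> x; apply: lt0r_neq0; exact: (stereo_den_gt0 (@vert_inj i) (x0 x) (x1 x)).
Qed.

Lemma facet_stereo_base i x : phi i x = sphere_base R (d i) <-> m i x = 0.
Proof.
split=> [/(congr1 set_val) e|/facet_height_eq0 h].
  apply/facet_height_eq0; apply/(stereo_row0 (@vert_inj i) (x0 x) (x1 x)).
  have -> : stereo_row (@vert i) (set_val x) = sphere_base_vec R (d i) by exact: e.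
  by rewrite mxE eqxx.
apply: val_inj => /=; exact: (stereo_row_boundary (@vert_inj i) (x0 x) (x1 x)).
Qed.

(** On the realization of [C] no index is picked, and [i0] merely names a sphere in which to write
    the common base point. *)
Definition facet_wedge_map x : W :=
  if [pick i | 0 < m i x] is Some i then lift (phi i x) else lift (sphere_base R (d i0)).
Local Notation f := facet_wedge_map.

(** The formula also holds on the boundary, where [phi i] reaches the base point. The sets on which
    it applies are therefore closed, and they cover the space, as pasting requires. *)
Lemma facet_wedge_mapE i x : (forall j, j != i -> m j x = 0) -> f x = lift (phi i x).
Proof.
move=> mj; rewrite /f; case: pickP => [j mjx|m0].
  have [-> //|ji] := eqVneq j i.
  by move: mjx; rewrite mj // ltxx.
have -> : phi i x = sphere_base R (d i).
  apply/facet_stereo_base; apply/eqP; rewrite eq_sym.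
  by have := minb_ge0 (sig i) (set_val x); rewrite le_eqVlt m0 orbF.
by apply/eqmodP/orP; right => /=; rewrite !eqxx.
Qed.

Lemma facet_cover x : exists i, forall j, j != i -> m j x = 0.
Proof.
have [_ mx|i _ mj _] := facetP card_sig sig_facet sig_inj (xL x).
  by exists i0 => j _.
by exists i.
Qed.

(** Pasting over a finite closed cover: on the set where all heights other than the one over facet
    [i] vanish, the map is [lift] after [phi i]. *)
Lemma continuous_facet_wedge_map : continuous f.
Proof.
apply/continuous_closedP => Z cZ.
have -> : f @^-1` Z = \bigcup_(i in [set: I])
    ((\bigcap_(j in [set j | j != i]) [set x | m j x = 0])
      `&` (fun x => lift (phi i x)) @^-1` Z).
  rewrite eqEsubset; split => x /=.
    by move=> Zx; have [i mi] := facet_cover x; exists i => //; split => //=;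
      rewrite -facet_wedge_mapE.
  by move=> [i _ [mi]] /=; rewrite (facet_wedge_mapE mi).
apply: closed_bigcup; first exact: finite_finset.
move=> i _; apply: closedI.
  apply: closed_bigI => j _.
  have /continuous_closedP/(_ _ (@closed_eq R 0)) // : continuous (fun x => m j x).
  exact (continuous_compose (@set_val_continuous _ _) (@continuous_minb R E (sig j))).
have /continuous_closedP/(_ _ cZ) // : continuous (fun x => lift (phi i x)).
exact: continuous_compose (@continuous_facet_stereo i) (@wedge_lift_continuous _ _ _ i).
Qed.

Local Notation C := (del_facets L sig).

Let inC x : realization C (set_val x) <-> forall i, m i x = 0.
Proof.
have CP := realization_del_facetsP card_sig sig_facet.
by split=> [/CP[]//|mx]; apply/CP.
Qed.

Lemma facet_wedge_map_del x y :
  realization C (set_val x) -> realization C (set_val y) -> f x = f y.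
Proof.
have fb z : realization C (set_val z) -> f z = lift (sphere_base R (d i0)).
  move=> /inC mz; rewrite (@facet_wedge_mapE i0) //; congr (lift _).
  by apply/facet_stereo_base.
by move=> /fb -> /fb ->.
Qed.

Let dpair_eq i (a b : sph i) : existT (fun i => sph i) i a = existT (fun i => sph i) i b -> a = b.
Proof. by move=> ab; have := existT_inj2 ab. Qed.

Let nbase i x : 0 < m i x -> phi i x <> sphere_base R (d i).
Proof. by move=> mx /facet_stereo_base m0; move: mx; rewrite m0 ltxx. Qed.

(** A point of an open facet is never sent to the base point, and two such points with the same
    image lie in the same facet, where [stereo_row_inj] separates them. *)
Lemma facet_wedge_map_fiber x y : f x = f y ->
  set_val x = set_val y \/ realization C (set_val x) /\ realization C (set_val y).
Proof.
have spec z := facetP card_sig sig_facet sig_inj (xL z).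
case: (spec x) => [Cx mx|i mi mj out]; case: (spec y) => [Cy my|i' mi' mj' out'].
- by right.
- rewrite (facet_wedge_mapE (fun j (_ : j != i0) => mx j)) (facet_wedge_mapE mj').
  move=> /wedge_lift_eq[e|[_ /nbase] //].
  have ii' : i0 = i' by exact: existT_inj1 e.
  subst i'; have /nbase := mi'; rewrite -(dpair_eq e).
  by case; apply/facet_stereo_base.
- rewrite (facet_wedge_mapE mj) (facet_wedge_mapE (fun j (_ : j != i0) => my j)).
  move=> /wedge_lift_eq[e|[/nbase] //].
  have ii' : i = i0 by exact: existT_inj1 e.
  subst i; have /nbase := mi; rewrite (dpair_eq e).
  by case; apply/facet_stereo_base.
rewrite (facet_wedge_mapE mj) (facet_wedge_mapE mj') => /wedge_lift_eq[e|[/nbase] //].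
have ii' : i = i' by exact: existT_inj1 e.
subst i'; left; apply: bary_inj => a.
have sxy : stereo_row (@vert i) (set_val x) = stereo_row (@vert i) (set_val y).
  exact: (congr1 set_val (dpair_eq e)).
have [/imsetP[j _ ->]|as_] := boolP (a \in sig i); last by rewrite out // out'.
apply: (stereo_row_inj (@vert_inj i) (x0 x) (x1 x) (x0 y) (x1 y) _ _ _ _ sxy).
- by rewrite facet_height_gt0.
- by rewrite facet_height_gt0.
- exact: sum_vert.
- exact: sum_vert.
Qed.

(** The point [c] is there to hit the base point; every other point of a sphere comes from its open
    facet by [stereo_row_surj]. *)
Lemma facet_wedge_map_surj (c : X) : realization C (set_val c) ->
  forall w, exists x, f x = w.
Proof.
move=> Cc w; have : [set: W] w by [].
rewrite -wedgeTE => -[i _ [a _ <-]].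
have [->|ab] := eqVneq a (sphere_base R (d i)).
  exists c; rewrite (@facet_wedge_mapE i) => [|j _]; last exact: (inC c).1.
  by congr (lift _); apply/facet_stereo_base; exact: (inC c).1.
have [|x [xx0 xx1 xout sx]] := @stereo_row_surj R E _ _ (@vert_inj i) (set_val a) (set_valP a).
  by apply: contra ab => /eqP ab; apply/eqP/val_inj.
have Lx : realization L x by apply: (realization_face fL (sigL i)).
pose x' : X := exist _ x (mem_set Lx).
have px : phi i x' = a by apply: val_inj.
exists x'; rewrite (@facet_wedge_mapE i) ?px // => j ji.
apply: (minb_gt0_unique sig_facet sig_inj Lx _ ji).
have := minb_ge0 (sig i) x; rewrite le_eqVlt => /orP[/eqP m0|//].
by move/eqP: ab; case; rewrite -px; apply/facet_stereo_base.
Qed.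

End facet_wedge.

(** * The equivalence for an arbitrary complex with such collapses *)

Definition point_complex (E : finType) (c : E) : set {set E} := [set [set c]%SET].

Lemma realization_point (R : realType) (E : finType) (c : E) (x : 'rV[R]_#|E|) :
  realization (point_complex c) x <-> x = bvec (fun e => (e == c)%:R).
Proof.
split=> [[x0 [x1 xc]]|->].
  have out e : e != c -> bary x e = 0.
    move=> ec; apply/eqP/negPn; have : e \notin [set c]%SET by rewrite inE.
    by rewrite -xc inE.
  apply: bary_inj => e; rewrite baryE; case: eqP => [->|/eqP /out -> //].
  by rewrite -[RHS]x1 (bigD1 c) //= big1 ?addr0.
have fP : face_closed (point_complex c).
  by move=> S S' ->; rewrite finset.subset1 => /orP[/eqP->//|/eqP->]; rewrite eqxx.
apply: (realization_face fP (erefl : point_complex c [set c]%SET)).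
- by move=> e; rewrite baryE.
- under eq_bigr do rewrite baryE.
  by rewrite (bigD1 c) //= eqxx big1 ?addr0 // => e /negPf ->.
- by move=> e; rewrite inE baryE => /negPf ->.
Qed.

(** Apart from the choice of [R], all hypotheses are finite combinatorial statements, in a form that
    a computation can decide. *)
Theorem facets_wedge_equivalence (R : realType) (E I : finType) (K L : set {set E})
    (d : I -> nat) (vert : forall i, 'I_(d i).+1 -> E) (i0 : I) (c : E) :
  face_closed K -> collapses K L ->
  (forall i, L (facet_of vert i)) ->
  (forall i, injective (vert i)) ->
  (forall i S, L S -> facet_of vert i \subset S -> S = facet_of vert i) ->
  injective (facet_of vert) ->
  collapses (del_facets L (facet_of vert)) (point_complex c) ->
  homotopy_equivalent R (set_type (realization K : set 'rV[R]_#|E|))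
    (@wedge I (fun i => set_type (@sphere R (d i)) : topologicalType)
      (fun i => @sphere_base R (d i))).
Proof.
move=> fK KL sigL vert_inj sig_facet sig_inj Cc.
have [fL [LK [D [cD D0 DK D1 Did]]]] := collapses_deforms R fK KL.
have card_sig i : #|facet_of vert i| = (d i).+1 by exact: card_facet.
have fC := face_closed_del_facets fL sig_facet.
have [_ [pC [H [cH H0 HC H1 _]]]] := collapses_deforms R fC Cc.
pose c0 : 'rV[R]_#|E| := bvec (fun e => (e == c)%:R).
have Cc0 : realization (del_facets L (facet_of vert)) c0 by apply/pC/realization_point.
have CL (x : 'rV[R]_#|E|) : realization (del_facets L (facet_of vert)) x -> realization L x.
  by move=> /(realization_del_facetsP card_sig sig_facet)[].
have eC t x : 0 <= t <= 1 -> realization (del_facets L (facet_of vert)) x ->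
    realization (del_facets L (facet_of vert)) (facet_extension d (facet_of vert) H (t, x)).
  by move=> t01 Cx; rewrite (facet_extension_del card_sig sig_facet) //;
    [exact: HC|case/andP: t01].
apply: (@collapse_contractible_equivalence R _ _ (realization K) (realization L)
  (realization (del_facets L (facet_of vert))) D
  (facet_extension d (facet_of vert) H) (facet_wedge_map vert_inj sig_facet i0) c0) => //.
- exact: continuous_facet_extension.
- by move=> x; exact: Did.
- exact: facet_extension0.
- by move=> t x; exact: facet_extension_realization.
- by move=> x Cx; rewrite (facet_extension_del card_sig sig_facet _ ler01 Cx); exact: (realization_point _ _).1 (H1 _ Cx).
- exact: compact_realization.
- apply: wedge_hausdorff => i; apply: (@hausdorff_injective _ _ set_val).
  + exact: set_val_continuous.
  + exact: val_inj.
  + exact: norm_hausdorff.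
- exact: continuous_facet_wedge_map.
- exact: (facet_wedge_map_surj fL sigL vert_inj sig_facet sig_inj i0 (c := exist _ c0 (mem_set (CL _ Cc0))) Cc0).
- by move=> x y; exact: facet_wedge_map_fiber.
- by move=> x y; exact: facet_wedge_map_del.
Qed.

Local Close Scope ring_scope.

(** * Complexes as lists of bit masks *)

Section masks.
Variables (E : finType) (n : nat) (code : E -> nat) (vtx : nat -> E).
Hypothesis code_lt : forall e, (code e < n)%N.
Hypothesis vtxK : forall i, (i < n)%N -> code (vtx i) = i.
Hypothesis codeK : forall e, vtx (code e) = e.
Implicit Types (m s : N) (l : seq N).

Definition bit m (i : nat) : bool := N.testbit m (N.of_nat i).
Definition set_of_mask m : {set E} := [set e | bit m (code e)]%SET.
(** Bits from [n] on are invisible to [set_of_mask]; below [2 ^ n] a mask is determined by its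
    set. *)
Definition in_range s := N.ltb s (N.shiftl 1 (N.of_nat n)).
Definition submask s m := N.eqb (N.land s m) s.
Definition add_bit m (i : nat) := N.setbit m (N.of_nat i).

Lemma bit_in_range s k : in_range s -> N.testbit s k -> exists2 e, k = N.of_nat (code e) & e \in set_of_mask s.
Proof.
rewrite /in_range N.shiftl_1_l => /N.ltb_lt s_lt sk.
have s_gt0 : (0 < s)%num by case: (s) sk.
have kn : (k < N.of_nat n)%num.
  apply/N.lt_nge => nk; move: sk; rewrite N.bits_above_log2 //.
  by apply: N.lt_le_trans nk; exact/N.log2_lt_pow2.
have k_n : (N.to_nat k < n)%N by lia.
by exists (vtx (N.to_nat k)); rewrite ?inE /bit vtxK // N2Nat.id.
Qed.

Lemma set_of_maskS s m : in_range s ->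
  (set_of_mask s \subset set_of_mask m) = submask s m.
Proof.
move=> sn; apply/fintype.subsetP/N.eqb_spec => [sm|sm e]; last first.
  by rewrite !inE /bit -{1}sm N.land_spec => /andP[].
apply: N.bits_inj => k; rewrite N.land_spec.
case sk : (N.testbit s k) => //=.
by have [e ->] := bit_in_range sn sk; move/sm; rewrite inE.
Qed.

Lemma set_of_mask_inj s s' : in_range s -> in_range s' ->
  set_of_mask s = set_of_mask s' -> s = s'.
Proof.
move=> sn sn' ss'.
have /N.eqb_spec <- : submask s s' by rewrite -set_of_maskS // ss'.
have /N.eqb_spec {2}<- : submask s' s by rewrite -set_of_maskS // ss'.
exact: N.land_comm.
Qed.

Lemma bit_add m i j : bit (add_bit m i) j = (j == i) || bit m j.
Proof.
rewrite /bit /add_bit N.setbit_eqb; congr (_ || _).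
apply/N.eqb_spec/eqP => [|->//]; lia.
Qed.

Lemma set_of_mask_add m i : (i < n)%N ->
  set_of_mask (add_bit m i) = (vtx i |: set_of_mask m)%SET.
Proof.
move=> i_n; apply/setP => e; rewrite !inE bit_add; congr (_ || _).
by apply/eqP/eqP => [<-|->]; [rewrite codeK|rewrite vtxK].
Qed.

Lemma set_of_mask0 : set_of_mask 0 = finset.set0.
Proof. by apply/setP => e; rewrite !inE. Qed.

Definition mask_of (t : seq nat) : N := foldr (fun i m => add_bit m i) 0%num t.

Lemma set_of_mask_of t : all (ltn^~ n) t ->
  set_of_mask (mask_of t) = [set e | code e \in t]%SET.
Proof.
elim: t => [_|i t IH /= /andP[i_n tn]]; first by rewrite set_of_mask0; apply/setP => e; rewrite !inE.
rewrite set_of_mask_add // IH //; apply/setP => e; rewrite !inE; congr (_ || _).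
by apply/eqP/eqP => [->|<-]; [rewrite vtxK|rewrite codeK].
Qed.

Definition mask_complex l : set {set E} := [set S | exists2 m, m \in l & S = set_of_mask m].
Definition mask_del l s := [seq m <- l | ~~ submask s m].
(* [vm_compute] evaluates both arguments of [&&] and [==>], hence the conditionals here and below. *)
Definition mask_cone l s (v : nat) := [&& s != 0%num, in_range s, (v < n)%N, ~~ bit s v
  & all (fun m => if submask s m then add_bit m v \in l else true) l].

Lemma mask_complex_del l s : in_range s ->
  del_star (mask_complex l) (set_of_mask s) = mask_complex (mask_del l s).
Proof.
move=> sn; apply/seteqP; split => S.
  by move=> [[m ml ->]]; rewrite set_of_maskS // => sm; exists m => //; rewrite mem_filter sm.
by move=> [m + ->]; rewrite mem_filter => /andP[sm ml]; split; [exists m|rewrite set_of_maskS].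
Qed.

Lemma mask_coneP l s v : mask_cone l s v -> cone_link (mask_complex l) (set_of_mask s) (vtx v).
Proof.
move=> /and5P[s0 sn vn sv /allP h]; split.
- have [|e _ es] := @bit_in_range s (N.log2 s) sn; last by apply/set0Pn; exists e.
  by apply: N.bit_log2; exact/eqP.
- by rewrite inE vtxK.
move=> S [m ml ->]; rewrite set_of_maskS // => sm.
by exists (add_bit m v); [have := h m ml; rewrite sm|rewrite set_of_mask_add].
Qed.

Fixpoint mask_run (st : seq (N * N)) l : option (seq N) :=
  if st is (s, v) :: st' then
    if mask_cone l s (N.to_nat v) then mask_run st' (mask_del l s) else None
  else Some l.

Lemma mask_run_collapses st l l' : mask_run st l = Some l' ->
  collapses (mask_complex l) (mask_complex l').
Proof.
elim: st l => [l [->]|[s v] st IH l /=]; first exact: collapses_refl.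
case: ifP => // c /IH lc; apply: (collapses_step (mask_coneP c)).
by rewrite mask_complex_del //; case/and5P: c.
Qed.

Lemma mask_complex_point i : (i < n)%N ->
  mask_complex [:: add_bit 0 i] = point_complex (vtx i).
Proof.
move=> i_n; apply/seteqP; split => S.
  by move=> [m]; rewrite inE => /eqP -> ->; rewrite set_of_mask_add // set_of_mask0 finset.setU0.
move=> ->; exists (add_bit 0 i); first by rewrite inE.
by rewrite set_of_mask_add // set_of_mask0 finset.setU0.
Qed.

Section enumeration.
Variables (good : {set E} -> Prop) (ok : N -> bool).
Hypothesis good0 : good finset.set0.
Hypothesis goodS : forall S S' : {set E}, good S -> S' \subset S -> good S'.
Hypothesis okP : forall m, ok m <-> good (set_of_mask m).

(** Vertices are offered one at a time and bad sets are dropped at once. Nothing is lost, since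
    removing the newest vertex from a good set leaves a good set; the [2 ^ n] subsets are never all
    formed. The empty mask is kept as a seed and filtered out at the end. *)
Fixpoint mask_enum (k : nat) : seq N :=
  if k is k'.+1 then let l := mask_enum k' in
    l ++ [seq m <- [seq add_bit m k' | m <- l] | ok m]
  else [:: 0%num].

Lemma mask_enumP k S : (k <= n)%N ->
  (good S /\ forall e, e \in S -> (code e < k)%N) <-> mask_complex (mask_enum k) S.
Proof.
elim: k S => [S _|k IH S kn].
  split=> [[_ S0]|[m]]; last first.
    by rewrite inE => /eqP -> ->; rewrite set_of_mask0; split => // e; rewrite inE.
  exists 0%num; rewrite ?inE // set_of_mask0; apply/setP => e; rewrite inE.
  by apply/negP => /S0.
split.
  move=> [gS Sk]; have [kS|kS] := boolP (vtx k \in S); last first.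
    have [|m ml ->] := (IH S (ltnW kn)).1; last by exists m => //=; rewrite mem_cat ml.
    split=> // e eS; have := Sk e eS; rewrite ltnS leq_eqVlt => /orP[/eqP ek|//].
    by move: kS; rewrite -ek codeK eS.
  have [|m ml Sm] := (IH (S :\ vtx k)%SET (ltnW kn)).1.
    split=> [|e]; first by apply: goodS gS _; exact: subD1set.
    rewrite !inE => /andP[ek eS]; have := Sk e eS; rewrite ltnS leq_eqVlt.
    by move=> /orP[/eqP ke|//]; move: ek; rewrite -ke codeK eqxx.
  have SE : S = set_of_mask (add_bit m k) by rewrite set_of_mask_add // -Sm finset.setD1K.
  exists (add_bit m k) => //=; rewrite mem_cat mem_filter; apply/orP; right; apply/andP; split.
    by apply/okP; rewrite -SE.
  by apply/mapP; exists m.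
move=> [m + ->] /=; rewrite mem_cat => /orP[ml|].
  have [|gm mk] := (IH (set_of_mask m) (ltnW kn)).2; first by exists m.
  by split=> // e /mk; exact: ltnW.
rewrite mem_filter => /andP[/okP gm /mapP[m' ml' mm']]; split => // e.
have [|_ mk] := (IH (set_of_mask m') (ltnW kn)).2; first by exists m'.
rewrite mm' set_of_mask_add // !inE => /orP[/eqP ->|em]; first by rewrite vtxK.
by apply: ltnW; rewrite ltnS; apply: mk; rewrite inE.
Qed.

Lemma mask_enum_complex : mask_complex [seq m <- mask_enum n | has (bit m) (iota 0 n)] =
  [set S | S != finset.set0 /\ good S].
Proof.
have hasP m : has (bit m) (iota 0 n) = (set_of_mask m != finset.set0).
  apply/hasP/set0Pn => [[i]|[e]].
    by rewrite mem_iota => /andP[_ i_n] mi; exists (vtx i); rewrite inE vtxK.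
  by rewrite inE => me; exists (code e) => //; rewrite mem_iota code_lt.
apply/seteqP; split => S.
  move=> [m + ->]; rewrite mem_filter hasP => /andP[m0 ml]; split => //.
  by have [] := (mask_enumP (set_of_mask m) (leqnn n)).2 (ex_intro2 _ _ m ml erefl).
move=> [S0 gS].
have [|m ml Sm] := (mask_enumP S (leqnn n)).1; first by split.
by exists m => //; rewrite mem_filter hasP -Sm S0 ml.
Qed.

End enumeration.

End masks.

(** * Acyclic matchings of the tetrahedron *)

(** Replacing cycles by sets without sinks avoids following paths, both for [peel] and for passing
    to submatchings. *)
Lemma acyclic_sinklessP (T : finType) (e : rel T) :
  (exists c : seq T, c != [::] /\ cycle e c) <->
  (exists X : {set T}, X != finset.set0 /\ forall x, x \in X -> exists2 y, y \in X & e x y).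
Proof.
split=> [[c [c0 ec]]|[X [/set0Pn[x0 Xx0] Xe]]].
  exists [set x in c]%SET; split.
    by apply/set0Pn; case: c c0 {ec} => // x c _; exists x; rewrite inE mem_head.
  move=> x; rewrite inE => xc; exists (next c x); first by rewrite inE mem_next.
  exact: next_cycle.
(* A vertex of [X] with the fewest reachable vertices: a successor in [X] reaches no more, hence by
   minimality as much, and so it reaches back to [x]. *)
have [x Xx xmin] := arg_minnP (fun x => #|connect e x|) Xx0.
have [y Xy exy] := Xe x Xx.
have yx : connect e y \subset connect e x.
  by apply/fintype.subsetP => z; rewrite !inE => yz; exact: connect_trans (connect1 exy) yz.
have : x \in connect e y.
  have /subset_leqif_card/leqifP := yx; case: ifP => [xy _|_].
    by apply: (fintype.subsetP xy); exact: connect0.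
  by rewrite ltnNge xmin.
move=> /connectP[p yp xl]; exists (y :: p); split=> //=.
by rewrite rcons_path yp -xl.
Qed.

Section peel.
Variables (T : finType) (e : rel T) (f : T -> nat) (A : seq (nat * nat)).
Hypothesis f_inj : injective f.
Hypothesis AP : forall p, reflect (exists x y, e x y /\ p = (f x, f y)) (p \in A).

(** Discards the arcs that end in a sink, which lie on no cycle. *)
Definition peel (B : seq (nat * nat)) := [seq p <- B | has (fun q => q.1 == p.2) B].

Lemma peel_stable B k : (size B <= k)%N -> peel (iter k peel B) = iter k peel B.
Proof.
elim: k B => [|k IH] B; first by rewrite leqn0 => /nilP ->.
move=> Bk; have [pB|/eqP pB] := eqVneq (peel B) B.
  by rewrite (_ : iter _ _ _ = B) //; elim: k.+1 => //= j ->.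
rewrite -[in LHS](addn1 k) -[in RHS](addn1 k) !iterD; apply: IH.
rewrite -ltnS; apply: leq_trans Bk; rewrite ltn_neqAle size_filter count_size andbT.
by apply/negP; rewrite -all_count => /all_filterP.
Qed.

(** Every round that changes the list shortens it, so [size A] rounds reach a fixed point. The
    sources of a nonempty fixed point form a set without sinks; conversely the arcs inside a
    sinkless set survive every round. *)
Lemma peel_acyclic k : (size A <= k)%N ->
  nilp (iter k peel A) <-> ~ exists c : seq T, c != [::] /\ cycle e c.
Proof.
move=> Ak; split=> [/nilP nilA /acyclic_sinklessP[X [/set0Pn[x Xx] Xe]]|nc].
  have sub j y z : y \in X -> z \in X -> e y z -> (f y, f z) \in iter j peel A.
    elim: j y z => [|j IH] y z Xy Xz yz; first by apply/AP; exists y, z.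
    rewrite /= mem_filter IH // andbT; have [w Xw zw] := Xe z Xz.
    by apply/hasP; exists (f z, f w) => //=; exact: IH.
  by have [y Xy xy] := Xe x Xx; have := sub k x y Xx Xy xy; rewrite nilA.
apply/negPn/negP => nB; apply: nc; apply/acyclic_sinklessP.
set B := iter k peel A in nB; have pB : peel B = B by exact: peel_stable.
have BA : {subset B <= A}.
  by rewrite /B; elim: (k) => //= j IH p; rewrite mem_filter => /andP[_ /IH].
exists [set x | has (fun p => p.1 == f x) B]%SET; split.
  case EB : B nB => [//|p B'] _; have pin : p \in B by rewrite EB mem_head.
  have /AP[x [y [xy pE]]] := BA _ pin.
  by apply/set0Pn; exists x; rewrite inE; apply/hasP; exists p; rewrite -?EB // pE.
move=> x; rewrite inE => /hasP[p pB' /eqP px].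
have /AP[x' [y [xy pE]]] := BA _ pB'; rewrite pE /= in px.
exists y; last by rewrite -(f_inj px).
have : p \in peel B by rewrite pB.
by rewrite mem_filter pE => /andP[h _]; rewrite inE.
Qed.

End peel.

(* In a cycle for [W'] all arcs from top-dimensional simplices are down arcs of [W'], and a vertex matched by [W'] is
   left along an edge outside [W]; so the top two dimensions of the cycle already form a cycle for [W]. *)
Lemma acyclic_submatching (V : finType) (K : pred {set V}) (W W' : {set HEdge K}) :
  is_matching W -> is_acyclic W -> W' \subset W -> is_acyclic W'.
Proof.
move=> mW aW /fintype.subsetP W'W /acyclic_sinklessP[X [/set0Pn[x0 Xx0] Xe]].
apply: aW; apply/acyclic_sinklessP.
have [t Xt tmax] := arg_maxnP (fun s : {set V} => #|s|) Xx0.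
have {}Xt : t \in X by [].
pose top := [set s in X | #|s| == #|t|]%SET.
have card_edge (e : HEdge K) : #|(val e).2| = #|(val e).1|.+1.
  by have /and4P[_ _ _ /eqP] := valP e.
have down (x y : {set V}) : x \in top -> y \in X -> modified_hasse W' x y ->
    exists2 e, e \in W' & val e = (y, x).
  rewrite inE => /andP[_ /eqP xt] Xy /existsP[e /orP[/andP[_ /eqP ve]|/andP[eW /eqP ve]]]; last by exists e.
  by have := tmax y Xy; have := card_edge e; rewrite ve /= => ->; rewrite xt /= ltnn.
exists (top :|: [set y in X | [exists x in top, modified_hasse W' x y]])%SET; split.
  by apply/set0Pn; exists t; rewrite !inE Xt eqxx.
move=> x; rewrite inE => /orP[xtop|].
  have Xx : x \in X by move: xtop; rewrite inE => /andP[].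
  have [y Xy xy] := Xe x Xx; exists y.
    by rewrite !inE Xy; apply/orP; right; apply/existsP; exists x; rewrite xtop.
  have [e eW ve] := down x y xtop Xy xy.
  by apply/existsP; exists e; rewrite W'W // ve eqxx orbT.
rewrite inE => /andP[Xx /existsP[s /andP[stop sx]]].
have [e eW ve] := down s x stop Xx sx.
have [y Xy /existsP[g /orP[/andP[gW /eqP vg]|/andP[gW /eqP vg]]]] := Xe x Xx.
  exists y.
    rewrite !inE Xy /=; apply/orP; left; apply/eqP.
    have := card_edge g; have := card_edge e; rewrite ve vg /= => <- ->.
    by move: stop; rewrite inE => /andP[_ /eqP].
  apply/existsP; exists g; rewrite vg eqxx andbT.
  apply/orP; left; apply/negP => gW1.
  have eg : e != g by apply: contraNneq gW => <-.
  by have [] := mW e g (W'W _ eW) gW1 eg; rewrite ve vg eqxx.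
have eg : e != g.
  apply/negP => /eqP eg; have := card_edge e; move: ve; rewrite eg vg => -[-> ->] /=.
  by move/eqP; rewrite -[X in X == _]addn0 -addn1 eqn_add2l.
by have [] := mW e g (W'W _ eW) (W'W _ gW) eg; rewrite ve vg eqxx.
Qed.

(** * The Hasse diagram of the tetrahedron boundary in numbers *)

Definition face_bit (s : {set 'I_4}) (k : nat) : bool := inord k \in s.
Definition face_code (s : {set 'I_4}) : nat :=
  face_bit s 0 + 2 * face_bit s 1 + 4 * face_bit s 2 + 8 * face_bit s 3.
Definition face_of_code (c : nat) : {set 'I_4} := [set i : 'I_4 | odd (c %/ 2 ^ i)]%SET.

Lemma face_subset (s t : {set 'I_4}) : (s \subset t) =
    [&& face_bit s 0 ==> face_bit t 0, face_bit s 1 ==> face_bit t 1,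
        face_bit s 2 ==> face_bit t 2 & face_bit s 3 ==> face_bit t 3].
Proof.
apply/fintype.subsetP/and4P => [h|[h0 h1 h2 h3] i]; first by split; apply/implyP; exact: h.
rewrite -(inord_val i).
by case: i => [[|[|[|[|//]]]] ?] /=; apply/implyP.
Qed.

Lemma face_code_inj : injective face_code.
Proof.
move=> s t; rewrite /face_code => st.
have sub (u v : {set 'I_4}) : face_code u = face_code v -> u \subset v.
  rewrite face_subset /face_code.
  by do 4![case: (face_bit u _); case: (face_bit v _) => //].
by apply/eqP; rewrite finset.eqEsubset !sub.
Qed.

Lemma card_face (s : {set 'I_4}) :
  #|s| = (face_bit s 0 + face_bit s 1 + face_bit s 2 + face_bit s 3)%N.
Proof.
rewrite -sum1_card big_mkcond /=.
rewrite (eq_bigr (fun i : 'I_4 => face_bit s i : nat)) => [|i _]; last first.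
  by rewrite /face_bit inord_val; case: (i \in s).
by rewrite -(big_mkord xpredT (fun k => face_bit s k : nat)) /= unlock /= addn0 !addnA.
Qed.

Lemma face_bit_code c k : (k < 4)%N -> face_bit (face_of_code c) k = odd (c %/ 2 ^ k).
Proof. by move=> k4; rewrite /face_bit inE inordK. Qed.

(** Twelve incidences of a vertex with an edge and twelve of an edge with a triangle, each face
    written as a four-bit number. *)
Definition hasse_codes : seq (nat * nat) :=
  [:: (1, 3); (1, 5); (1, 9); (2, 3); (2, 6); (2, 10); (3, 7); (3, 11);
      (4, 5); (4, 6); (4, 12); (5, 7); (5, 13); (6, 7); (6, 14); (8, 9);
      (8, 10); (8, 12); (9, 11); (9, 13); (10, 11); (10, 14); (12, 13); (12, 14)]%N.

(** Both sides are Boolean functions of the eight membership bits of [s] and [t], so a case analysis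
    settles all 256 cases. *)
Lemma hasse_edge_bits (s t : {set 'I_4}) :
  hasse_edge bdry_tetra (s, t) = ((face_code s, face_code t) \in hasse_codes).
Proof.
rewrite /hasse_edge /bdry_tetra /= properE.
rewrite !face_subset !card_face /face_code.
by do 4![case: (face_bit s _); case: (face_bit t _)].
Qed.

Local Notation E := (HEdge bdry_tetra).

Definition edge_pair (e : E) : nat * nat := (face_code (val e).1, face_code (val e).2).
Definition edge_code (e : E) : nat := index (edge_pair e) hasse_codes.

Lemma edge_pair_inj : injective edge_pair.
Proof.
move=> e e' [h1 h2]; apply: val_inj; rewrite [LHS]surjective_pairing [RHS]surjective_pairing.
by rewrite (face_code_inj h1) (face_code_inj h2).
Qed.

Lemma edge_pair_in e : edge_pair e \in hasse_codes.
Proof. by rewrite -hasse_edge_bits -surjective_pairing; exact: valP. Qed.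

Lemma edge_code_lt e : (edge_code e < 24)%N.
Proof. by have := edge_pair_in e; rewrite -index_mem. Qed.

Lemma edge_code_nth e : nth (0, 0)%N hasse_codes (edge_code e) = edge_pair e.
Proof. exact: nth_index (edge_pair_in e). Qed.

Lemma face_codeK c : (c < 16)%N -> face_code (face_of_code c) = c.
Proof.
move=> c16; rewrite /face_code !face_bit_code //.
by move: c16; do 16![case: c => [|c] //].
Qed.

Lemma edge_of_subproof i : (i < 24)%N -> hasse_edge bdry_tetra
  (face_of_code (nth (0, 0)%N hasse_codes i).1, face_of_code (nth (0, 0)%N hasse_codes i).2).
Proof.
move=> i24; rewrite hasse_edge_bits.
have /allP h : all (fun p => (p.1 < 16) && (p.2 < 16))%N hasse_codes by [].
have pin : nth (0, 0)%N hasse_codes i \in hasse_codes by exact: mem_nth.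
have /andP[h1 h2] := h _ pin.
by rewrite !face_codeK // -surjective_pairing.
Qed.

(** Beyond index 23 the default, edge 0, may be returned; the inverse laws are stated below 24
    only. *)
Definition edge_of (i : nat) : E := insubd
  (exist (fun p => is_true (hasse_edge bdry_tetra p)) _ (@edge_of_subproof 0 isT))
  (face_of_code (nth (0, 0)%N hasse_codes i).1, face_of_code (nth (0, 0)%N hasse_codes i).2).

Lemma edge_pair_of i : (i < 24)%N -> edge_pair (edge_of i) = nth (0, 0)%N hasse_codes i.
Proof.
move=> i24; rewrite /edge_pair /edge_of insubdK ?inE /=; last exact: edge_of_subproof.
have /allP h : all (fun p => (p.1 < 16) && (p.2 < 16))%N hasse_codes by [].
have pin : nth (0, 0)%N hasse_codes i \in hasse_codes by exact: mem_nth.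
have /andP[h1 h2] := h _ pin.
by rewrite !face_codeK // -surjective_pairing.
Qed.

Lemma edge_ofK i : (i < 24)%N -> edge_code (edge_of i) = i.
Proof. by move=> i24; rewrite /edge_code edge_pair_of // index_uniq. Qed.

Lemma edge_codeK e : edge_of (edge_code e) = e.
Proof. by apply: edge_pair_inj; rewrite edge_pair_of ?edge_code_lt // edge_code_nth. Qed.

Local Notation dec := (set_of_mask edge_code).

Definition selected (m : N) : seq (nat * nat) :=
  [seq nth (0, 0)%N hasse_codes i | i <- iota 0 24 & bit m i].

Definition matching_mask (m : N) : bool :=
  let es := selected m in
  all (fun p => all (fun q => (p == q) ||
    [&& p.1 != q.1, p.1 != q.2, p.2 != q.1 & p.2 != q.2]) es) es.

Definition arcs (m : N) : seq (nat * nat) :=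
  [seq (let p := nth (0, 0)%N hasse_codes i in if bit m i then (p.2, p.1) else p) | i <- iota 0 24].

(** Reversing edges keeps their number, so 24 rounds of peeling always suffice. *)
Definition acyclic_mask (m : N) : bool := nilp (iter 24 peel (arcs m)).

Definition acyclic_matching_mask m := if matching_mask m then acyclic_mask m else false.

Definition acyclic_matching (W : {set E}) := is_matching W /\ is_acyclic W.

Lemma selectedP m p : reflect (exists2 e, e \in dec m & p = edge_pair e) (p \in selected m).
Proof.
apply: (iffP mapP) => [[i]|[e]].
  rewrite mem_filter mem_iota => /andP[mi /andP[_ i24]] ->.
  by exists (edge_of i); rewrite ?inE ?edge_pair_of ?edge_ofK.
rewrite inE => me ->; exists (edge_code e); last by rewrite edge_code_nth.
by rewrite mem_filter me mem_iota /= edge_code_lt.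
Qed.

Lemma matching_maskP m : matching_mask m <-> is_matching (dec m).
Proof.
have disj (e f : E) : [&& (edge_pair e).1 != (edge_pair f).1, (edge_pair e).1 != (edge_pair f).2,
      (edge_pair e).2 != (edge_pair f).1 & (edge_pair e).2 != (edge_pair f).2] <->
    [/\ (val e).1 != (val f).1, (val e).1 != (val f).2,
        (val e).2 != (val f).1 & (val e).2 != (val f).2].
  by rewrite /= !(inj_eq face_code_inj); split=> [/and4P//|?]; apply/and4P.
have sel e : e \in dec m -> edge_pair e \in selected m by move=> em; apply/selectedP; exists e.
rewrite /matching_mask; split=> [/allP h e f em fm ef|h].
  have /allP hf := h _ (sel e em); have := hf _ (sel f fm).
  by rewrite (inj_eq edge_pair_inj) (negPf ef) => ?; apply/disj.
apply/allP => p /selectedP[e em ->]; apply/allP => q /selectedP[f fm ->].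
by rewrite (inj_eq edge_pair_inj); have [//|ef] := eqVneq e f; apply/disj/h.
Qed.

Lemma arcsP m p : reflect
  (exists x y, modified_hasse (dec m) x y /\ p = (face_code x, face_code y)) (p \in arcs m).
Proof.
apply: (iffP mapP) => [[i]|[x [y [/existsP[e he] ->]]]].
  rewrite mem_iota => /andP[_ i24] ->; rewrite -(edge_pair_of i24) -[in bit m i](edge_ofK i24).
  case mi : (bit m _); [exists (val (edge_of i)).2, (val (edge_of i)).1
    |exists (val (edge_of i)).1, (val (edge_of i)).2]; split => //; apply/existsP;
    exists (edge_of i); rewrite inE mi /= -surjective_pairing eqxx ?orbT //.
exists (edge_code e); first by rewrite mem_iota edge_code_lt.
rewrite edge_code_nth /edge_pair; move: he; rewrite inE.
by case: (bit m _) => /=; rewrite ?orbF ?orFb => /eqP ->.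
Qed.

Lemma acyclic_maskP m : acyclic_mask m <-> is_acyclic (dec m).
Proof. by apply: (peel_acyclic face_code_inj (arcsP m)); rewrite size_map size_iota. Qed.

Lemma if_and_iff (a b : bool) (P Q : Prop) :
  (a <-> P) -> (b <-> Q) -> (if a then b else false) <-> P /\ Q.
Proof. by case: a; case: b => -[h1 h2] [h3 h4]; split=> [|[/h2 ? /h4 ?]]; auto. Qed.

Lemma acyclic_matching_maskP m : acyclic_matching_mask m <-> acyclic_matching (dec m).
Proof. exact (if_and_iff (matching_maskP m) (acyclic_maskP m)). Qed.

Lemma acyclic_matching0 : acyclic_matching finset.set0.
Proof. by rewrite -(set_of_mask0 edge_code); apply/acyclic_matching_maskP; vm_compute. Qed.


Lemma acyclic_matchingS (W W' : {set E}) : acyclic_matching W -> W' \subset W -> acyclic_matching W'.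
Proof.
move=> [mW aW] W'W; split; last exact: acyclic_submatching aW W'W.
by move=> e f eW fW; apply: mW; exact: (fintype.subsetP W'W).
Qed.

(** * The certificate *)

Section check.
Variables facets3 facets4 : seq (seq nat).
Let I := ('I_21 + 'I_24)%type.
Let facets := facets3 ++ facets4.
Let facet_masks := map mask_of facets.

(** The first chain leads from [l0] to [l]. The listed simplices must be distinct members of [l], of
    the right sizes, with no proper coface in [l], and the second chain must bring the rest of [l]
    down to vertex 23. *)
Definition check_wedge (l0 : seq N) (st st' : seq (N * N)) : bool :=
  if mask_run 24 st l0 is Some l then
    [&& size facets3 == 21, size facets4 == 24,
        all (fun t => size t == 4) facets3, all (fun t => size t == 5) facets4,
        all (fun t => uniq t && all (ltn^~ 24) t) facets,
        uniq facet_masks, all (in_range 24) facet_masks, all (mem l) facet_masks,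
        all (fun s => all (fun m => if submask s m then m == s else true) l) facet_masks
      & mask_run 24 st' [seq m <- l | m \notin facet_masks] == Some [:: add_bit 0 23]]
  else false.

Definition facet_index (i : I) : nat := match i with inl a => a | inr b => 21 + b end.
Definition facet_list (i : I) : seq nat := nth [::] facets (facet_index i).
Definition facet_vertex (i : I) (j : 'I_(sph_dim 3 4 i).+1) : E :=
  edge_of (nth 0 (facet_list i) j).

Lemma facet_index_lt i : (facet_index i < 45)%N.
Proof. by case: i => -[a] /=; lia. Qed.

Lemma facet_index_inj : injective facet_index.
Proof.
move=> [[a ha]|[a ha]] [[b hb]|[b hb]] /= h; try lia; congr (_ _); apply: val_inj => /=; lia.
Qed.

Lemma check_wedgeP (R : realType) (l0 : seq N) (st st' : seq (N * N)) :
  face_closed (mask_complex edge_code l0) -> check_wedge l0 st st' ->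
  homotopy_equivalent R
    (set_type (@realization R _ (mask_complex edge_code l0)) : topologicalType)
    (sphere_wedge R 3 4 21 24).
Proof.
move=> fl0; rewrite /check_wedge.
case run : mask_run => [l|//].
case/and5P => /eqP sz3 /eqP sz4 /allP all3 /allP all4.
case/and5P => /allP wf ms_uniq /allP ms_range /allP ms_l.
case/andP => /allP ms_facet /eqP run'.
have szf : size facets = 45 by rewrite size_cat sz3 sz4.
have fin i : facet_list i \in facets by rewrite mem_nth // szf facet_index_lt.
have szi i : size (facet_list i) = (sph_dim 3 4 i).+1.
  rewrite /facet_list /facets nth_cat sz3; case: i => i; rewrite /facet_index.
    by rewrite ltn_ord; apply/eqP/all3/mem_nth; rewrite sz3.
  by rewrite ltnNge leq_addr addKn; apply/eqP/all4/mem_nth; rewrite sz4.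
have mskE i : mask_of (facet_list i) = nth 0%num facet_masks (facet_index i).
  by rewrite (nth_map [::]) // szf facet_index_lt.
have msk i : mask_of (facet_list i) \in facet_masks by exact: map_f.
have facetE i : facet_of facet_vertex i = dec (mask_of (facet_list i)).
  have /andP[_ lt] := wf _ (fin i).
  rewrite (set_of_mask_of edge_ofK edge_codeK lt).
  apply/setP => e; rewrite inE; apply/imsetP/idP => [[j _ ->]|ei].
    have ji : (nth 0 (facet_list i) j \in facet_list i)%N by rewrite mem_nth // szi.
    by rewrite edge_ofK //; exact: (allP lt).
  have ji : (index (edge_code e) (facet_list i) < (sph_dim 3 4 i).+1)%N.
    by rewrite -szi index_mem.
  by exists (Ordinal ji) => //; rewrite /facet_vertex /= nth_index // edge_codeK.
have mask_inj i i' : dec (mask_of (facet_list i)) = dec (mask_of (facet_list i')) -> i = i'.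
  move=> /(set_of_mask_inj edge_ofK (ms_range _ (msk i)) (ms_range _ (msk i'))).
  rewrite !mskE => /eqP; rewrite nth_uniq ?size_map ?szf ?facet_index_lt // => /eqP.
  exact: facet_index_inj.
have facet_max i m : m \in l -> dec (mask_of (facet_list i)) \subset dec m ->
    m = mask_of (facet_list i).
  move=> ml; rewrite (set_of_maskS edge_ofK) ?ms_range // => sm.
  by have /allP/(_ m ml) := ms_facet _ (msk i); rewrite sm => /eqP.
(* [inl ord0] is an arbitrary index for the base point; vertex 23 is the one on which the second
   chain ends. *)
apply: (@facets_wedge_equivalence R _ I (mask_complex edge_code l0) (mask_complex edge_code l)
  (@sph_dim 3 4 21 24) facet_vertex (inl ord0) (edge_of 23)).
- exact: fl0.
- exact: (mask_run_collapses edge_ofK edge_codeK run).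
- by move=> i; rewrite facetE; exists (mask_of (facet_list i)) => //; exact: ms_l.
- move=> i j j' /(congr1 edge_code).
  have /andP[un lt] := wf _ (fin i).
  have lt' (k : 'I_(sph_dim 3 4 i).+1) : (nth 0 (facet_list i) k < 24)%N.
    by apply: (allP lt); rewrite mem_nth // szi.
  rewrite !edge_ofK // => /eqP; rewrite nth_uniq ?szi // => /eqP.
  exact: val_inj.
- by move=> i S [m ml ->]; rewrite facetE => /(facet_max i m ml) ->.
- by move=> i i'; rewrite !facetE; exact: mask_inj.
rewrite (_ : del_facets _ _ = mask_complex edge_code [seq m <- l | m \notin facet_masks]).
  rewrite -(mask_complex_point edge_ofK edge_codeK (isT : 23 < 24)%N).
  exact: (mask_run_collapses edge_ofK edge_codeK run').
apply/seteqP; split => S.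
  move=> [[m ml ->] ne]; exists m => //; rewrite mem_filter ml andbT.
  apply/negP => /(nthP 0%num)[k]; rewrite size_map szf => k45 mk.
  have [i ik] : exists i, facet_index i = k.
    case: (ltnP k 21) => [k21|k21]; first by exists (inl (Ordinal k21)).
    have k24 : (k - 21 < 24)%N by lia.
    by exists (inr (Ordinal k24)) => /=; lia.
  by apply: (ne i); rewrite facetE mskE ik mk.
move=> [m]; rewrite mem_filter => /andP[nm ml] ->; split; first by exists m.
move=> i; rewrite facetE => mi; move: nm.
by rewrite (facet_max i m ml) ?msk // mi.
Qed.

End check.

Definition morse_masks := [seq m <- mask_enum acyclic_matching_mask 24 | has (bit m) (iota 0 24)].

Lemma morse_masksE : mask_complex edge_code morse_masks = @morse_complex _ bdry_tetra.
Proof.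
rewrite /morse_masks (mask_enum_complex edge_code_lt edge_ofK edge_codeK acyclic_matching0 acyclic_matchingS acyclic_matching_maskP).
by apply/seteqP; split => W.
Qed.

Lemma face_closed_morse : face_closed (@morse_complex _ bdry_tetra).
Proof. by move=> W W' [_ gW] W'W W'0; split => //; exact: acyclic_matchingS gW W'W. Qed.

(* Found by a computer search. A simplex of the matching complex is encoded by the bit mask of its vertices, a vertex by
   its position in [hasse_codes], and a pair (s, v) is a collapse of the open star of s towards v. *)
Definition steps_to_spheres : seq (N * N) := [::
  (1048594, 6); (69696, 2); (2130176, 22); (8421377, 20); (589840, 23); (263184, 21); (8228, 7);
  (526352, 0); (1168, 21); (8390688, 9); (49280, 5); (131090, 21); (1179650, 19); (2621696, 17);
  (66624, 14); (8912904, 16); (65553, 18); (393728, 21); (524808, 11); (262162, 6); (49153, 20);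
  (131202, 19); (1120, 14); (4194817, 11); (131140, 12); (262224, 8); (8390664, 9); (8392736, 9);
  (69648, 23); (1056770, 3); (33025, 22); (8388865, 13); (5242882, 15); (131586, 19); (1060, 7);
  (147584, 5); (66564, 7); (2359312, 17); (1056772, 3); (4194337, 18); (49408, 22); (69633, 18);
  (526848, 0); (1049602, 19); (4456456, 16); (2105348, 3); (131168, 14); (66049, 23); (40992, 7);
  (33032, 20); (263232, 1); (266272, 0); (1048848, 6); (73732, 7); (2105346, 3); (1049090, 6);
  (4259841, 18); (2098240, 4); (8914944, 16); (262720, 1); (69640, 18); (1049664, 4); (33856, 12);
  (1573376, 17); (525440, 1); (526368, 14); (9437186, 15); (590336, 1); (4194321, 11);
  (131712, 21); (2097412, 22); (4210689, 8); (1064962, 3); (591872, 14); (133248, 2); (131204, 12);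
  (45056, 10); (1042, 19); (2359360, 17); (67585, 18); (1090, 14); (524928, 1); (2228352, 4);
  (655488, 8); (1092, 12); (5259264, 3); (1064964, 3); (2129922, 22); (49216, 5); (8396804, 8);
  (2081, 18); (8388620, 20); (8458240, 9); (1573120, 17); (49154, 22); (4196384, 9); (2621568, 4);
  (4194824, 11); (8454145, 13); (2097416, 13); (524832, 23); (4194561, 13); (8392712, 9);
  (51200, 10); (5242881, 15); (131232, 13); (77824, 10); (655872, 21); (524864, 1); (133152, 14);
  (139268, 12); (16644, 22); (1048833, 17); (8654848, 0); (70656, 14); (8388618, 13); (268, 22);
  (2084, 7); (8650760, 16); (2097472, 4); (524432, 23); (524560, 6); (4456464, 16); (34848, 7);
  (67588, 7); (3104, 14); (2359552, 0); (4227073, 21); (2097536, 4); (327696, 23); (264208, 0);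
  (1065216, 3); (2097409, 17); (1097728, 3); (8452, 22); (69636, 7); (393280, 14); (81924, 22);
  (40961, 10); (131138, 19); (1048836, 6); (68608, 14); (12292, 10); (50176, 12); (8652800, 9);
  (131648, 12); (131108, 12); (524306, 6); (147460, 3); (135200, 0); (33824, 7); (66688, 1);
  (2228288, 4); (1048840, 13); (8421384, 20); (8388872, 13); (5243136, 15); (2228226, 3);
  (8392705, 20); (1081600, 23); (12320, 10); (8456192, 7); (2097170, 22); (2138112, 3);
  (18436, 10); (5251072, 3); (266256, 0); (16452, 5); (5152, 14); (1184, 1); (67600, 7);
  (16420, 7); (4132, 9); (4194568, 16); (5242888, 11); (20484, 10); (41216, 7); (8390657, 20);
  (4235264, 1); (266760, 21); (2360322, 3); (36960, 9); (41992, 20); (41090, 23); (328200, 11);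
  (37024, 9); (5252, 21); (6291468, 11); (266753, 21); (655680, 14); (8716800, 1); (35968, 21);
  (8658945, 5); (2097730, 22); (8921089, 5); (1572944, 17); (83976, 18); (1183808, 4);
  (2622466, 3); (8389153, 18); (4456992, 1); (4262016, 9); (4229128, 21); (2752528, 0);
  (4524032, 9); (4268040, 1); (4276232, 1); (264705, 21); (3204, 21); (1573904, 0); (2097794, 22);
  (38016, 21); (2622480, 0); (262664, 11); (1572880, 0); (8651266, 5); (328194, 22)]%num.

Definition facets3 : seq (seq nat) := [::
  [:: 1; 3; 19; 21]; [:: 5; 6; 12; 14]; [:: 1; 9; 18; 22]; [:: 6; 8; 17; 20]; [:: 8; 13; 21; 22];
  [:: 3; 11; 16; 22]; [:: 0; 9; 18; 21]; [:: 2; 7; 14; 22]; [:: 3; 11; 16; 18]; [:: 0; 4; 17; 19];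
  [:: 1; 6; 21; 22]; [:: 4; 6; 12; 17]; [:: 2; 3; 11; 22]; [:: 5; 9; 12; 15]; [:: 5; 7; 9; 12];
  [:: 0; 13; 21; 22]; [:: 5; 11; 14; 18]; [:: 7; 12; 14; 16]; [:: 1; 6; 15; 20]; [:: 1; 3; 21; 22];
  [:: 7; 13; 15; 23]]%N.

Definition facets4 : seq (seq nat) := [::
  [:: 6; 9; 12; 15; 21]; [:: 0; 8; 13; 16; 19]; [:: 3; 12; 17; 18; 21]; [:: 6; 8; 14; 16; 19];
  [:: 0; 10; 12; 14; 18]; [:: 5; 7; 8; 14; 22]; [:: 4; 6; 8; 15; 23]; [:: 6; 8; 16; 18; 23];
  [:: 1; 3; 14; 16; 19]; [:: 2; 9; 11; 21; 22]; [:: 2; 4; 12; 17; 21]; [:: 2; 4; 6; 16; 22];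
  [:: 2; 4; 7; 11; 21]; [:: 0; 4; 10; 11; 20]; [:: 4; 7; 8; 16; 23]; [:: 0; 5; 10; 14; 19];
  [:: 0; 9; 12; 17; 20]; [:: 2; 9; 12; 17; 20]; [:: 7; 8; 16; 19; 23]; [:: 0; 10; 11; 14; 20];
  [:: 5; 8; 13; 17; 18]; [:: 1; 5; 6; 9; 23]; [:: 2; 9; 12; 20; 23]; [:: 8; 14; 16; 18; 22]]%N.

(** These start from what the first chain leaves, without the 45 facets; the closing steps, with [s]
    a power of two, delete single vertices until 23 is alone. *)
Definition steps_to_point : seq (N * N) := [::
  (2101824, 2); (2130496, 22); (2134080, 4); (2097728, 2); (2101312, 2); (2097220, 4);
  (2129984, 4); (73985, 18); (598017, 10); (590081, 14); (589825, 14); (65537, 18); (2363400, 10);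
  (2494464, 0); (2364416, 0); (590144, 23); (606272, 1); (540992, 5); (524608, 5); (589888, 23);
  (524384, 1); (282625, 17); (21505, 20); (283648, 3); (267265, 13); (267264, 13); (274432, 17);
  (266248, 17); (21512, 20); (151560, 20); (151553, 20); (4210848, 1); (4211072, 16); (16800, 19);
  (16768, 19); (540800, 1); (82050, 22); (606464, 3); (590088, 13); (82184, 18); (540936, 17);
  (16648, 17); (264, 13); (8421648, 7); (8421696, 5); (33104, 22); (33040, 22); (33024, 5);
  (8651072, 5); (8716352, 1); (8716544, 13); (8650816, 1); (8716288, 13); (8650754, 5);
  (8658944, 5); (336128, 22); (8388960, 2); (4464896, 5); (8388708, 9); (4530176, 1); (4268288, 7);
  (8388900, 7); (356, 22); (4268032, 1); (292, 7); (36, 9); (4464642, 5); (4202626, 5);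
  (4194720, 13); (606208, 10); (590848, 13); (66560, 18); (335872, 3); (589832, 1); (81928, 1);
  (6294016, 15); (6293508, 4); (6291972, 7); (6291460, 7); (6292096, 15); (6291600, 15);
  (6293520, 15); (2228244, 11); (135188, 20); (2232336, 0); (131092, 11); (133136, 0);
  (1179665, 12); (4259860, 7); (65620, 23); (65556, 7); (2099344, 15); (2099220, 10);
  (2097300, 12); (2099332, 9); (2097172, 10); (2097296, 12); (1044, 20); (1049604, 3); (3076, 21);
  (5124, 21); (2134144, 9); (4244, 23); (2097796, 12); (37008, 23); (2099840, 15); (36992, 9);
  (8393344, 2); (1049617, 12); (1051664, 15); (1050641, 15); (3089, 21); (3088, 21); (1049616, 12);
  (2099216, 0); (2065, 15); (32785, 12); (33808, 12); (2098192, 0); (8454416, 6); (8389008, 2);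
  (8454288, 1); (65936, 22); (65680, 1); (65552, 6); (18, 15); (32912, 11); (4194448, 2);
  (34832, 20); (2064, 2); (8390656, 9); (5242896, 6); (5242880, 9); (4196480, 9); (2180, 9);
  (4194324, 6); (4194372, 16); (65604, 23); (65540, 7); (66112, 1); (4194564, 7); (66050, 7);
  (324, 23); (541728, 1); (17441, 18); (525345, 13); (17440, 18); (1056, 13); (525314, 3);
  (263170, 3); (279552, 11); (263168, 21); (278536, 17); (2367488, 17); (2490368, 11);
  (270338, 17); (270344, 17); (139266, 19); (131106, 14); (655362, 3); (395265, 14); (1053185, 15);
  (135681, 21); (1183745, 13); (1180161, 11); (131585, 21); (2561, 15); (34817, 10); (1083392, 3);
  (34824, 21); (33793, 12); (33800, 12); (2129921, 12); (35840, 21); (5128, 13); (12296, 17);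
  (139272, 19); (33288, 12); (2109440, 0); (2106368, 19); (2622464, 11); (9217, 20); (2623488, 17);
  (533504, 20); (1187841, 19); (2752513, 13); (1184256, 3); (135684, 21); (1183748, 3);
  (1180164, 11); (1050628, 3); (135680, 21); (131584, 11); (131076, 3); (2099204, 9); (1051136, 3);
  (2097668, 12); (1048588, 12); (590080, 13); (589824, 1); (524416, 5); (416, 13); (8913152, 5);
  (8921088, 5); (73984, 7); (73856, 1); (8396834, 7); (17409, 19); (1068032, 3); (543744, 3);
  (542721, 17); (1590272, 3); (1067009, 17); (1573889, 11); (1589249, 17); (1573888, 3);
  (1067008, 17); (1181696, 19); (1589248, 17); (542720, 3); (401408, 0); (139296, 19);
  (131104, 14); (524544, 0); (289, 18); (16641, 18); (8388704, 15); (8421408, 7); (32864, 22);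
  (4194880, 1); (32802, 7); (4194848, 7); (32898, 9); (8389186, 15); (674, 23); (1049092, 6);
  (1048580, 4); (68, 12); (8392768, 15); (36928, 20); (9441280, 15); (8389184, 20); (4116, 23);
  (8421456, 20); (327936, 6); (82176, 22); (4456704, 5); (16672, 6); (4456512, 1); (4472832, 1);
  (4210944, 6); (81984, 1); (327744, 1); (4210752, 5); (262210, 5); (4192, 9); (4672, 20);
  (1052736, 4); (608, 1); (576, 15); (1179904, 13); (1048832, 23); (6291712, 4); (2097408, 17);
  (4194576, 6); (2228240, 0); (4261888, 9); (4259848, 1); (4210692, 3); (16388, 10); (327688, 1);
  (65546, 13); (73728, 23); (65544, 9); (8388616, 20); (1049096, 12); (1053184, 15); (8454656, 7);
  (655376, 6); (6291520, 4); (2097216, 19); (4194320, 15); (4227136, 1); (2129936, 12);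
  (2097168, 0); (32848, 20); (2621442, 9); (524802, 23); (524800, 0); (2621441, 13); (2097665, 12);
  (135232, 14); (4160, 10); (1088, 19); (1040, 0); (524304, 23); (8912960, 1); (8912896, 5);
  (541696, 3); (525312, 11); (2052, 9); (4194316, 13); (4194308, 7); (8196, 10); (1028, 21);
  (2097156, 12); (12, 9); (520, 21); (4196360, 21); (36896, 14); (53248, 3); (49152, 22);
  (32800, 7); (20488, 20); (4210720, 1); (4210696, 1); (4256, 14); (4128, 0); (4609, 15);
  (32769, 20); (1049088, 23); (513, 18); (8651264, 5); (20481, 20); (1064961, 17); (1179649, 19);
  (6299648, 3); (6291457, 11); (4194305, 18); (4202504, 1); (2105345, 17); (2105344, 19);
  (2621440, 3); (4202498, 5); (4458496, 9); (4196352, 15); (4464640, 5); (4456960, 16);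
  (4456448, 1); (4260352, 7); (327682, 14); (81922, 22); (4210688, 7); (264224, 9); (2080, 7);
  (672, 23); (544, 1); (262178, 14); (262658, 21); (2097666, 22); (278530, 17); (262146, 3);
  (262152, 11); (131074, 14); (16544, 1); (16514, 10); (395264, 14); (17410, 3); (8388642, 7);
  (6291968, 15); (16394, 19); (8388768, 13); (540680, 17); (20608, 10); (16512, 11); (81920, 18);
  (327680, 9); (262656, 21); (69632, 7); (264192, 0); (2359296, 0); (66048, 7); (2560, 15);
  (266240, 17); (20480, 20); (1064960, 3); (34816, 7); (16392, 11); (17408, 11); (67584, 7);
  (18432, 17); (2176, 21); (32832, 23); (8388674, 16); (65602, 22); (65538, 7); (65536, 8);
  (4194368, 5); (8388672, 4); (80, 17); (4194560, 13); (4194336, 7); (1048640, 19); (160, 1);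
  (131136, 14); (4202496, 7); (524352, 14); (66, 5); (64, 18); (34, 19); (16640, 17); (524320, 0);
  (16386, 19); (16384, 0); (1048578, 3); (524290, 3); (532488, 20); (1179664, 12); (4194312, 15);
  (6291456, 7); (4194304, 9); (2097154, 10); (10, 13); (1026, 7); (2, 23); (8200, 20); (32776, 12);
  (1032, 11); (2097160, 17); (2099200, 0); (3072, 20); (2048, 19); (8, 20); (524288, 13);
  (2097153, 12); (1025, 20); (2228224, 12); (1179648, 12); (8421504, 9); (8421888, 12);
  (8389120, 2); (4100, 7); (8392704, 4); (4608, 21); (512, 7); (2097152, 10); (36864, 20);
  (1024, 13); (1052672, 0); (4096, 17); (1048576, 23); (17, 18); (131072, 8); (32896, 13);
  (32768, 23); (257, 13); (1, 5); (262144, 8); (32, 23); (16, 2); (8192, 7); (128, 23); (4, 23);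
  (256, 23)]%num.

(** A single evaluation lists the acyclic matchings, replays both chains with their cone tests and
    checks the facets. The search behind the certificate need not be trusted. *)
Lemma check_wedge_morse :
  check_wedge facets3 facets4 morse_masks steps_to_spheres steps_to_point.
Proof. by vm_compute. Qed.

Unset Implicit Arguments.
Local Open Scope ring_scope.

Theorem mainTheorem11 (R : realType) :
  homotopy_equivalent R
    (set_type (@realization R _ (@morse_complex _ bdry_tetra)) : topologicalType)
    (sphere_wedge R 3 4 21 24).
Proof.
have := face_closed_morse; rewrite -morse_masksE => fK.
exact (check_wedgeP R fK check_wedge_morse).
Qed.
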